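(* Let $\beta_1,B_1,\alpha_2,\gamma_2>0$ satisfy $\beta_1-B_1\gamma_2=2\sqrt{B_1\alpha_2}$, and consider the system $$x_{n+1}=\frac{\beta_1x_n}{B_1x_n+y_n},\qquad y_{n+1}=\frac{\alpha_2+\gamma_2y_n}{x_n},\qquad n=0,1,2,\ldots,$$ with initial conditions $x_0>0$, $y_0\ge 0$. The unique equilibrium $$E=\left(\frac{B_1\gamma_2+\beta_1}{2B_1},\ \frac{\beta_1-B_1\gamma_2}{2}\right)$$ of this system is non-hyperbolic and semi-stable. With $\mathcal{C}$, $\mathcal{W}_-$, $\mathcal{W}_+$ the sets associated with $E$ described in the context, the basin of attraction of $E$ is $\mathcal{C}\cup\mathcal{W}_+$, and the orbit of every point in $\mathcal{W}_-$ is asymptotic to $(0,\infty)$ (that is, $x_n\to 0$ and $y_n\to\infty$).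
   Context: Let $T(x,y)=\left(\frac{\beta_1x}{B_1x+y},\frac{\alpha_2+\gamma_2y}{x}\right)$ on $\mathcal{R}=(0,\infty)\times[0,\infty)$. The Jacobian of $T$ at $E$ has eigenvalues $\lambda_1=1$ and $\lambda_2\in(-1,0)$. ''Semi-stable'' is not formally defined; it refers to $E$ attracting the orbits on one side of $\mathcal{C}$ and not those on the other, as made precise by the description of the basin of attraction (set of points with $T^n(\mathrm{x})\to E$). South-East order: $(x,y)\preceq_{se}(s,t)$ iff $x\le s$ and $y\ge t$. $\mathcal{C}\subset\mathcal{R}$ is the (inclusion-maximal) curve through $E$ that is invariant ($T(\mathcal{C})\subset\mathcal{C}$), is contained in the basin of attraction of $E$, is tangential at $E$ to the eigenspace associated with $\lambda_2$, and is the graph of a strictly increasing continuous function of the first coordinate on an interval; it exists, has no endpoint in $\mathrm{int}\,\mathcal{R}$, and separates $\mathcal{R}$ into the two connected sets $\mathcal{W}_-=\{\mathrm{x}\in\mathcal{R}\setminus\mathcal{C}:\exists\,\mathrm{y}\in\mathcal{C},\ \mathrm{x}\preceq_{se}\mathrm{y}\}$ and $\mathcal{W}_+=\{\mathrm{x}\in\mathcal{R}\setminus\mathcal{C}:\exists\,\mathrm{y}\in\mathcal{C},\ \mathrm{y}\preceq_{se}\mathrm{x}\}$. *)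

(* Defs.v *)
(* MathComp / MathComp-Analysis; the reals are an arbitrary [R : realType]. *)
From mathcomp Require Import all_boot all_order all_algebra.
From mathcomp Require Import all_classical all_reals all_analysis.
From mathcomp Require Import complex.

Set Implicit Arguments.
Unset Strict Implicit.
Unset Printing Implicit Defensive.

Import Order.TTheory GRing.Theory Num.Theory.
Import numFieldNormedType.Exports.

Local Open Scope classical_set_scope.
Local Open Scope ring_scope.

Definition dom (R : realType) : set (R * R) := [set p | 0 < p.1 /\ 0 <= p.2].
Arguments dom R : clear implicits.

(* Total on R * R (division by 0 yields 0); it maps [dom R] into itself, and
   only its orbits in [dom R] matter. *)
Definition Tmap (R : realType) (beta1 B1 alpha2 gamma2 : R) (p : R * R) : R * R :=
  (beta1 * p.1 / (B1 * p.1 + p.2), (alpha2 + gamma2 * p.2) / p.1).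

Definition equi (R : realType) (beta1 B1 gamma2 : R) : R * R :=
  ((B1 * gamma2 + beta1) / (2 * B1), (beta1 - B1 * gamma2) / 2).

Definition le_se (R : realType) (p q : R * R) : Prop := p.1 <= q.1 /\ q.2 <= p.2.

Definition equilibria (R : realType) (T : R * R -> R * R) : set (R * R) :=
  [set p | dom R p /\ T p = p].

Definition basin (R : realType) (T : R * R -> R * R) (E : R * R) : set (R * R) :=
  [set p | dom R p /\ (fun n => iter n T p) @ \oo --> E].

Definition asymptotic_0_infty (R : realType) (T : R * R -> R * R) (p : R * R) : Prop :=
  (fun n => (iter n T p).1) @ \oo --> (0 : R) /\
  (fun n => (iter n T p).2) @ \oo --> +oo.

Definition row_of_pair (R : realType) (p : R * R) : 'rV[R]_2 :=
  \row_(j < 2) (if j == 0 then p.1 else p.2).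

Definition pair_of_row (R : realType) (v : 'rV[R]_2) : R * R := (v 0 0, v 0 1).

(* The library's Jacobian matrix acts on row vectors ([u *m jac T p] is the
   differential of T at p applied to u), which is also the convention of
   [eigenvalue] and [eigenspace]. *)
Definition jac (R : realType) (T : R * R -> R * R) (p : R * R) : 'M[R]_2 :=
  jacobian (fun v => row_of_pair (T (pair_of_row v))) (row_of_pair p).

(* Complex eigenvalues: the Jacobian matrix has one on the unit circle. *)
Definition nonhyperbolic (R : realType) (T : R * R -> R * R) (p : R * R) : Prop :=
  exists2 z : R[i], eigenvalue (map_mx (real_complex R) (jac T p)) z & `|z| = 1.

(* [C] is the graph over [I] of a continuous strictly increasing function. *)
Definition graph_over (R : realType) (I : set R) (f : R -> R) : set (R * R) :=
  [set p | I p.1 /\ p.2 = f p.1].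

Definition increasing_on (R : realType) (I : set R) (f : R -> R) : Prop :=
  [/\ is_interval I, I° !=set0, {within I, continuous f} &
      forall x y, I x -> I y -> x < y -> f x < f y].

(* The slopes of the chords from (e, f e) have a limit s along I, and the
   direction (1, s) of the resulting tangent line lies in the eigenspace of J
   for lambda. *)
Definition tangent_to_eigenspace (R : realType) (I : set R) (f : R -> R) (e : R)
    (J : 'M[R]_2) (lambda : R) : Prop :=
  exists s : R,
    (fun x => (f x - f e) / (x - e)) @ within I e^' --> s /\
    (row_of_pair (1, s) <= eigenspace J lambda)%MS.

Definition admissible_curve (R : realType) (T : R * R -> R * R) (E : R * R)
    (lambda : R) (C : set (R * R)) : Prop :=
  [/\ C `<=` dom R, C E, T @` C `<=` C, C `<=` basin T E &
      exists I f, [/\ C = graph_over I f, increasing_on I f &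
                      tangent_to_eigenspace I f E.1 (jac T E) lambda]].

Definition maximal_curve (R : realType) (T : R * R -> R * R) (E : R * R)
    (lambda : R) (C : set (R * R)) : Prop :=
  admissible_curve T E lambda C /\
  forall C', admissible_curve T E lambda C' -> C `<=` C' -> C' = C.

(* For the graph C of a continuous increasing function on an interval
   I = fst @` C: the points of the closure of C above an endpoint of I, whether
   or not this endpoint belongs to I. *)
Definition curve_endpoint (R : realType) (C : set (R * R)) : set (R * R) :=
  [set p | closure C p /\
           (closure (fst @` C) `\` (fst @` C)°) p.1].

Definition Wminus (R : realType) (C : set (R * R)) : set (R * R) :=
  [set p | (dom R `\` C) p /\ exists2 q, C q & le_se p q].

Definition Wplus (R : realType) (C : set (R * R)) : set (R * R) :=
  [set p | (dom R `\` C) p /\ exists2 q, C q & le_se q p].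

Definition separates (R : realType) (C : set (R * R)) : Prop :=
  [/\ dom R `\` C = Wminus C `|` Wplus C,
      separated (Wminus C) (Wplus C),
      Wminus C !=set0 /\ Wplus C !=set0,
      connected (Wminus C) & connected (Wplus C)].

(* E attracts the orbits starting on one side of C and none of those starting
   on the other side. *)
Definition semi_stable (R : realType) (T : R * R -> R * R) (E : R * R)
    (C : set (R * R)) : Prop :=
  (Wplus C `<=` basin T E /\ Wminus C `&` basin T E = set0) \/
  (Wminus C `<=` basin T E /\ Wplus C `&` basin T E = set0).

(* Main.v *)
(* T is strongly monotone for the South-East order.  The points (M, 0) with M
   large, resp. E + t(-1, B1) with t > 0 small, start orbits decreasing to E,
   resp. to (0, oo).  Comparison with them shows that an orbit entering the
   North-West quadrant of E, at a point other than E, goes to (0, oo), and that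
   all other orbits converge to E: either they enter the South-East quadrant, or
   they stay in a cone of directions of positive slope where convergence of the
   upper comparison orbit forces convergence.  Hence the basin is closed in the
   domain, and a point strictly above (in the order) a basin point is interior
   to the basin; its boundary is the curve C, the graph of an increasing
   continuous function.

   On C the deviation u from E in the first coordinate contracts by a factor
   c / (k + c) < 1, while the linearization preserves the component of p - E
   along the eigenvalue 1, so that this component is O(u^2): C is tangent to the
   lambda2-eigenspace.  Any admissible curve lies in C: otherwise it would
   contain a point p strictly above some q in C; both orbits converge
   geometrically to E with ratio c / (k + c), but the gap between two ordered
   orbits contracts more slowly, by factors tending to 1. *)
Require Import Defs.
From mathcomp Require Import all_boot all_order all_algebra.
From mathcomp Require Import all_classical all_reals all_analysis.
From mathcomp Require Import complex ring lra.

Set Implicit Arguments.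
Unset Strict Implicit.
Unset Printing Implicit Defensive.

Import Order.TTheory GRing.Theory Num.Theory.
Import numFieldNormedType.Exports.

Local Open Scope classical_set_scope.
Local Open Scope ring_scope.

Ltac pos :=
  lazymatch goal with
  | |- is_true (0 < _ - _) => rewrite subr_gt0; solve [assumption | lra]
  | |- is_true (0 <= _ - _) =>
      rewrite subr_ge0; solve [assumption | apply: ltW; assumption | lra]
  | |- is_true (0 < _ + _) =>
      first [ apply: addr_gt0; solve [pos] | apply: ltr_pwDl; solve [pos]
            | apply: ltr_wpDl; solve [pos] ]
  | |- is_true (0 <= _ + _) => apply: addr_ge0; pos
  | |- is_true (0 < _ * _) => apply: mulr_gt0; pos
  | |- is_true (0 <= _ * _) => apply: mulr_ge0; pos
  | |- is_true (0 < _ ^-1) => rewrite invr_gt0; pos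
  | |- is_true (0 <= _ ^-1) => rewrite invr_ge0; pos
  | |- is_true (0 < _ ^+ _) => apply: exprn_gt0; pos
  | |- is_true (0 <= _ ^+ _) => apply: exprn_ge0; pos
  | |- is_true (0 <= _) => solve [done | assumption | apply: ltW; assumption]
  | |- _ => solve [done | assumption]
  end.

(* In the critical case put [k = gamma2] and [c = sqrt (B1 alpha2) / B1]: then
   [beta1 = B1 (k + 2 c)], [alpha2 = B1 c^2] and [E = (k + c, B1 c)]. *)
Definition Tcrit (R : realType) (B c k : R) : R * R -> R * R :=
  Tmap (B * (k + 2 * c)) B (B * c ^+ 2) k.

Definition Ecrit (R : realType) (B c k : R) : R * R := (k + c, B * c).

Definition lt_se (R : realType) (p q : R * R) : Prop := p.1 < q.1 /\ q.2 < p.2.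

(** * Determinant and characteristic polynomial of a two by two matrix *)

Lemma det_mx22 (F : comNzRingType) (A : 'M[F]_2) :
  \det A = A 0 0 * A 1 1 - A 0 1 * A 1 0.
Proof.
rewrite (expand_det_row _ 0) !big_ord_recl big_ord0 addr0 /cofactor !det_mx11.
rewrite 2!mxE [in X in _ + X]mxE [in X in _ + X]mxE.
have -> : lift ord0 ord0 = 1 :> 'I_2 by exact: val_inj.
have -> : lift 1 0 = 0 :> 'I_2 by exact: val_inj.
by rewrite expr0 mul1r expr1 mulN1r mulrN.
Qed.

Lemma char_poly_mx22 (F : comNzRingType) (A : 'M[F]_2) : char_poly A =
  'X^2 - (A 0 0 + A 1 1)%:P * 'X + (A 0 0 * A 1 1 - A 0 1 * A 1 0)%:P.
Proof.
rewrite /char_poly det_mx22 !mxE.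
rewrite !(mulr1n, mulr0n, sub0r, polyCB, polyCD, polyCM).
by ring.
Qed.

Section CriticalSystem.
Variables (R : realType) (B c k : R).
Hypotheses (B_gt0 : 0 < B) (c_gt0 : 0 < c) (k_gt0 : 0 < k).

Notation T := (Tcrit B c k).
Notation E := (Ecrit B c k).
Notation dom := (dom R).

Implicit Types p q : R * R.

(** * Monotonicity *)

Lemma Tcrit1 p : (T p).1 = B * (k + 2 * c) * p.1 / (B * p.1 + p.2).
Proof. by []. Qed.

Lemma Tcrit2 p : (T p).2 = (B * c ^+ 2 + k * p.2) / p.1.
Proof. by []. Qed.

Lemma dom_sum_gt0 p : dom p -> 0 < B * p.1 + p.2.
Proof. by case=> x0 y0; rewrite ltr_pwDl // mulr_gt0. Qed.

Lemma Tcrit_pos p : dom p -> 0 < (T p).1 /\ 0 < (T p).2.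
Proof.
move=> dp; have s0 := dom_sum_gt0 dp; case: dp => x0 y0.
by split; rewrite ?Tcrit1 ?Tcrit2; pos.
Qed.

Lemma Tcrit_dom p : dom p -> dom (T p).
Proof. by move=> /Tcrit_pos[x0 y0]; split => //; exact: ltW. Qed.

Lemma iter_dom p n : dom p -> dom (iter n T p).
Proof. by move=> dp; elim: n => //= n; exact: Tcrit_dom. Qed.

Lemma Ecrit_dom : dom E.
Proof. by split => /=; rewrite ?addr_gt0 // mulr_ge0 // ltW. Qed.

(** Once its denominator is cleared, each coordinate of [T p - E] is exactly linear in the
    deviations of [p]. The sign, contraction and differentiability arguments below all start from
    this identity and [Tcrit_dev2]. *)
Lemma Tcrit_dev1 p : dom p ->
  ((T p).1 - (k + c)) * (B * p.1 + p.2) =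
  B * c * (p.1 - (k + c)) - (k + c) * (p.2 - B * c).
Proof.
move=> /dom_sum_gt0/lt0r_neq0 s0; rewrite Tcrit1.
by field.
Qed.

Lemma Tcrit_dev2 p : dom p ->
  ((T p).2 - B * c) * p.1 = k * (p.2 - B * c) - B * c * (p.1 - (k + c)).
Proof. by case=> /lt0r_neq0 x0 _; rewrite Tcrit2; field. Qed.

Lemma Tcrit_fixed : T E = E.
Proof.
have dE := Ecrit_dom; have s0 := dom_sum_gt0 dE.
apply/eqP; rewrite xpair_eqE; apply/andP; split; rewrite -subr_eq0.
  have := Tcrit_dev1 dE; rewrite /= !subrr !mulr0 subrr => /eqP.
  by rewrite mulf_eq0 (gt_eqF s0) orbF.
have := Tcrit_dev2 dE; rewrite /= !subrr !mulr0 subrr => /eqP.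
by rewrite mulf_eq0 (gt_eqF (proj1 dE)) orbF.
Qed.

Lemma iter_E n : iter n T E = E.
Proof. by elim: n => //= n ->; exact: Tcrit_fixed. Qed.

Lemma Tcrit_fixed_unique p : dom p -> T p = p -> p = E.
Proof.
move=> dp Tp; have := Tcrit_dev1 dp; have := Tcrit_dev2 dp; rewrite Tp.
case: p dp {Tp} => x y [/= x0 y0] h2 h1.
have xy : y = B * (k + 2 * c) - B * x.
  have : x * (B * x + y) = x * (B * (k + 2 * c)).
    by transitivity (B * (k + 2 * c) * x); [lra | ring].
  by move/(mulfI (lt0r_neq0 x0)) <-; ring.
(* The critical relation between the parameters makes the quadratic for [x] a perfect square. *)
have : B * (x - (k + c)) ^+ 2 = 0 by rewrite xy in h2; nra.
move/eqP; rewrite mulf_eq0 gt_eqF //= sqrf_eq0 subr_eq0 => /eqP xE.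
by rewrite /Ecrit xy xE; congr pair; ring.
Qed.

(** The coefficients of the gaps [q.1 - p.1] and [p.2 - q.2] are nonnegative on the domain, so
    monotonicity is read off the formula. *)
Lemma Tcrit_diff1 p q : dom p -> dom q ->
  (T q).1 - (T p).1 = B * (k + 2 * c) *
    ((q.1 - p.1) * p.2 + p.1 * (p.2 - q.2)) /
    ((B * p.1 + p.2) * (B * q.1 + q.2)).
Proof.
move=> /dom_sum_gt0/lt0r_neq0 sp /dom_sum_gt0/lt0r_neq0 sq.
by rewrite !Tcrit1; field; rewrite sp sq.
Qed.

Lemma Tcrit_diff2 p q : dom p -> dom q ->
  (T p).2 - (T q).2 =
    ((q.1 - p.1) * (B * c ^+ 2 + k * p.2) + k * p.1 * (p.2 - q.2)) /
    (p.1 * q.1).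
Proof.
case=> /lt0r_neq0 xp _ [/lt0r_neq0 xq _].
by rewrite !Tcrit2; field; rewrite xp xq.
Qed.

Lemma le_se_refl p : le_se p p. Proof. by split. Qed.

Lemma Tcrit_mono p q : dom p -> dom q -> le_se p q -> le_se (T p) (T q).
Proof.
move=> dp dq [xpq yqp]; have sp := dom_sum_gt0 dp; have sq := dom_sum_gt0 dq.
case: (dp) (dq) => xp yp [xq yq].
split; rewrite -subr_ge0 ?Tcrit_diff1 ?Tcrit_diff2 //; pos.
Qed.

Lemma iter_mono p q n : dom p -> dom q -> le_se p q ->
  le_se (iter n T p) (iter n T q).
Proof.
move=> dp dq pq; elim: n => //= n; apply: Tcrit_mono; exact: iter_dom.
Qed.

(** One step makes the second coordinates strictly ordered, but not always the first ones: [T] sends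
    the whole axis [y = 0] to the first coordinate [k + 2 c]. The second step, taken from positive
    coordinates, separates both. *)
Lemma Tcrit_strict_mono2 p q : dom p -> dom q -> le_se p q -> p <> q ->
  lt_se (T (T p)) (T (T q)).
Proof.
move=> dp dq pq neq; have dTp := Tcrit_dom dp; have dTq := Tcrit_dom dq.
have [Tpq1 Tpq2] := Tcrit_mono dp dq pq.
have Tlt : (T q).2 < (T p).2.
  case: (dp) (dq) pq => xp yp [xq yq] [xpq yqp].
  rewrite -subr_gt0 Tcrit_diff2 //.
  have [xe|xlt] := eqVneq p.1 q.1.
    have ylt : q.2 < p.2.
      rewrite lt_neqAle yqp andbT; apply/eqP => ye; apply: neq.
      by rewrite [p]surjective_pairing [q]surjective_pairing xe ye.
    by pos.
  have xlt' : p.1 < q.1 by rewrite lt_neqAle xlt.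
  by pos.
have [Tpx Tpy] := Tcrit_pos dp; have [Tqx Tqy] := Tcrit_pos dq.
have sp := dom_sum_gt0 dTp; have sq := dom_sum_gt0 dTq.
by split; rewrite -subr_gt0 ?(Tcrit_diff1 dTp dTq) ?(Tcrit_diff2 dTp dTq); pos.
Qed.

(* With [u = p.1 - (k + c)] and [v = p.2 - B c], the image of [p] has its two
   deviations of signs [B c u - (k + c) v] and [k v - B c u]. *)
Lemma cone_bounds p : dom p ->
  0 < (p.1 - (k + c)) * (p.2 - B * c) ->
  0 <= ((T p).1 - (k + c)) * ((T p).2 - B * c) ->
  B * c * `|p.1 - (k + c)| <= (k + c) * `|p.2 - B * c| /\
  k * `|p.2 - B * c| <= B * c * `|p.1 - (k + c)|.
Proof.
move=> dp; have := Tcrit_dev1 dp; have := Tcrit_dev2 dp.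
have := dom_sum_gt0 dp; have [x0 y0] := dp.
move: (p.1 - _) (p.2 - _) ((T p).1 - _) ((T p).2 - _) => u v u' v'.
move: (B * p.1 + p.2) => s s0 e2 e1 uv uv'.
have h : 0 <= (B * c * u - (k + c) * v) * (k * v - B * c * u).
  by rewrite -e1 -e2 mulrACA mulr_ge0 // ltW // mulr_gt0.
have Bc0 : 0 < B * c by rewrite mulr_gt0.
have Bck : B * c * k < B * c * (k + c) by rewrite ltr_pM2l // ltrDl.
have [u0|u0|u0] := ltrgtP u 0; last by rewrite u0 mul0r ltxx in uv.
  have v0 : v < 0 by rewrite nmulr_rgt0 in uv.
  rewrite !ltr0_norm //; split; rewrite leNgt; apply/negP => hh.
    have : k * v - B * c * u > 0 by nra.
    by nra.
  have : B * c * u - (k + c) * v > 0 by nra.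
  by nra.
have v0 : 0 < v by rewrite pmulr_rgt0 in uv.
rewrite !gtr0_norm //; split; rewrite leNgt; apply/negP => hh.
  have : k * v - B * c * u < 0 by nra.
  by nra.
have : B * c * u - (k + c) * v < 0 by nra.
by nra.
Qed.

(** * Global dynamics *)

Lemma Tcrit_cvg (S : Type) (F : set_system S) (FF : Filter F) (f : S -> R * R)
    (x y : R) : 0 < x -> 0 <= y ->
  (fun s => (f s).1) @ F --> x -> (fun s => (f s).2) @ F --> y ->
  (fun s => (T (f s)).1) @ F --> (T (x, y)).1 /\
  (fun s => (T (f s)).2) @ F --> (T (x, y)).2.
Proof.
move=> x0 y0 fx fy; rewrite Tcrit1 Tcrit2 /=; split.
  apply: cvgM; first by apply: cvgM => //; exact: cvg_cst.
  apply: cvgV; first by rewrite gt_eqF // ltr_pwDl // mulr_gt0.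
  by apply: cvgD => //; apply: cvgM => //; exact: cvg_cst.
apply: cvgM; last by apply: cvgV; rewrite // gt_eqF.
by apply: cvgD; [exact: cvg_cst|apply: cvgM => //; exact: cvg_cst].
Qed.

Lemma seq_lim_ge (u : nat -> R) (l a : R) :
  u @ \oo --> l -> (forall n, a <= u n) -> a <= l.
Proof.
move=> ul au; rewrite -(cvg_lim (@Rhausdorff R) ul).
by apply: limr_ge; [apply/cvg_ex; exists l|exact: nearW].
Qed.

Lemma orbit_lim_fixed p (x y : R) : 0 < x -> 0 <= y ->
  (fun n => (iter n T p).1) @ \oo --> x ->
  (fun n => (iter n T p).2) @ \oo --> y -> (x, y) = E.
Proof.
move=> x0 y0 px py; apply: Tcrit_fixed_unique => //.
have [Tx Ty] := Tcrit_cvg eventually_filter x0 y0 px py.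
rewrite [LHS]surjective_pairing; congr pair.
  apply: (cvg_unique (@Rhausdorff R) Tx).
  by move: px; rewrite -(cvg_shiftS (fun n => (iter n T p).1)).
apply: (cvg_unique (@Rhausdorff R) Ty).
by move: py; rewrite -(cvg_shiftS (fun n => (iter n T p).2)).
Qed.

Lemma basinP p : basin T E p <-> dom p /\
  ((fun n => (iter n T p).1) @ \oo --> k + c /\
   (fun n => (iter n T p).2) @ \oo --> B * c).
Proof.
split=> -[dp].
  move=> pE; split=> //; split.
    exact: (cvg_comp (fun n => iter n T p) fst pE cvg_fst).
  exact: (cvg_comp (fun n => iter n T p) snd pE cvg_snd).
case=> px py; split => //.
have -> : (fun n => iter n T p) = (fun n => ((iter n T p).1, (iter n T p).2)).
  by apply/funext => n; exact: surjective_pairing.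
exact: (cvg_pair px py).
Qed.

Lemma basin_asymptotic p : basin T E p -> asymptotic_0_infty T p -> False.
Proof.
move=> /basinP[_ [px _]] [p0 _].
have : k + c = 0 by exact: (cvg_unique (@Rhausdorff R) px p0).
by move/eqP; rewrite gt_eqF // addr_gt0.
Qed.

Lemma orbit_shift (g : R * R -> R) N p (F : set_system R) :
  ((fun n => g (iter n T (iter N T p))) @ \oo --> F) =
  ((fun n => g (iter n T p)) @ \oo --> F).
Proof.
rewrite -(cvg_shiftn N (fun n => g (iter n T p))).
suff -> : (fun n => g (iter n T (iter N T p))) =
    [sequence g (iter (n + N) T p)]_n by [].
by apply/funext => n; rewrite /= iterD.
Qed.

Lemma basin_iter N p : dom p -> basin T E (iter N T p) <-> basin T E p.
Proof.
move=> dp; rewrite !basinP (orbit_shift fst) (orbit_shift snd).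
by split=> -[_ ?]; split=> //; exact: iter_dom.
Qed.

Lemma asymptotic_iter N p :
  asymptotic_0_infty T (iter N T p) -> asymptotic_0_infty T p.
Proof.
by rewrite /asymptotic_0_infty (orbit_shift fst) (orbit_shift snd).
Qed.

Lemma asymptotic_down p q : dom p -> dom q -> le_se p q ->
  asymptotic_0_infty T q -> asymptotic_0_infty T p.
Proof.
move=> dp dq pq [qx qy]; split.
  apply: (@squeeze_cvgr _ _ _ _ (fun=> 0) (fun n => (iter n T q).1)) => //;
    last exact: cvg_cst.
  apply: nearW => n; rewrite ltW /=; last exact: (iter_dom _ dp).1.
  exact: (iter_mono _ dp dq pq).1.
apply: ger_cvgy qy; apply: nearW => n.
exact: (iter_mono _ dp dq pq).2.
Qed.

Lemma iter_decreasing q : dom q -> le_se (T q) q ->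
  {homo (fun n => (iter n T q).1) : n m / (n <= m)%N >-> m <= n} /\
  {homo (fun n => (iter n T q).2) : n m / (n <= m)%N >-> n <= m}.
Proof.
move=> dq Tq.
have h n : le_se (iter n.+1 T q) (iter n T q).
  by rewrite iterSr; apply: iter_mono => //; exact: Tcrit_dom.
split; [apply/nonincreasing_seqP | apply/nondecreasing_seqP] => n.
  exact: (h n).1.
exact: (h n).2.
Qed.

(** Both coordinates are monotone and bounded by those of [E]; their limit is a fixed point of the
    domain, hence [E]. *)
Lemma decreasing_to_E q : dom q -> le_se (T q) q -> le_se E q -> basin T E q.
Proof.
move=> dq Tq Eq; have [mx my] := iter_decreasing dq Tq.
have dE := Ecrit_dom.
have hE n : le_se E (iter n T q).
  by have := iter_mono n dE dq Eq; rewrite iter_E.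
have bx : has_lbound (range (fun n => (iter n T q).1)).
  by exists (k + c) => _ [n _ <-]; exact: (hE n).1.
have byy : has_ubound (range (fun n => (iter n T q).2)).
  by exists (B * c) => _ [n _ <-]; exact: (hE n).2.
have /cvg_ex[x xl] := nonincreasing_is_cvgn mx bx.
have /cvg_ex[y yl] := nondecreasing_is_cvgn my byy.
have x0 : 0 < x.
  apply: (@lt_le_trans _ _ (k + c)); first by rewrite addr_gt0.
  by apply: (seq_lim_ge xl) => n; exact: (hE n).1.
have y0 : 0 <= y.
  by apply: (seq_lim_ge yl) => n; exact: (iter_dom n dq).2.
have [xE yE] := orbit_lim_fixed x0 y0 xl yl.
by apply/basinP; split => //; rewrite -xE -yE.
Qed.

Lemma decreasing_to_infty q : dom q -> le_se (T q) q -> le_se q E -> q <> E ->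
  asymptotic_0_infty T q.
Proof.
move=> dq Tq qE neq; have [mx my] := iter_decreasing dq Tq.
have dn n : dom (iter n T q) by exact: iter_dom.
have bx : has_lbound (range (fun n => (iter n T q).1)).
  by exists 0 => _ [n _ <-]; apply/ltW; exact: (dn n).1.
have /cvg_ex[/= x xl] := nonincreasing_is_cvgn mx bx.
have x_ge0 : 0 <= x.
  by apply: (seq_lim_ge xl) => n; apply/ltW; exact: (dn n).1.
have hx n : x <= (iter n T q).1.
  by rewrite -(cvg_lim (@Rhausdorff R) xl); apply: nonincreasing_cvgn_ge => //;
     apply/cvg_ex; exists x.
(* The first recurrence solved for the second coordinate: it bounds the second coordinates as long
   as the first ones stay away from 0, and a positive limit [x] would then yield the fixed point
   [E], which a decreasing orbit starting below [E] cannot approach. *)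
have dev n : (iter n T q).2 =
    B * (k + 2 * c) * (iter n T q).1 / (iter n.+1 T q).1 - B * (iter n T q).1.
  have [xn0 yn0] := dn n; have sn := dom_sum_gt0 (dn n).
  rewrite iterS Tcrit1; field.
  by rewrite !gt_eqF //; pos.
have x0 : x = 0.
  apply/eqP; rewrite eq_le x_ge0 andbT leNgt; apply/negP => xpos.
  have byy : has_ubound (range (fun n => (iter n T q).2)).
    exists (B * (k + 2 * c) * q.1 / x) => _ [n _ <-]; rewrite dev.
    have [xn0 yn0] := dn n; have [xn0' _] := dn n.+1.
    apply: (@le_trans _ _ (B * (k + 2 * c) * (iter n T q).1 / (iter n.+1 T q).1)).
      by rewrite gerBl; pos.
    apply: ler_pM; [by pos|by pos| |by rewrite lef_pV2 ?posrE].
    by rewrite ler_pM2l; [exact: (mx 0%N)|pos].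
  have /cvg_ex[/= y yl] := nondecreasing_is_cvgn my byy.
  have y_ge0 : 0 <= y by apply: (seq_lim_ge yl) => n; exact: (dn n).2.
  have hy n : (iter n T q).2 <= y.
    rewrite -(cvg_lim (@Rhausdorff R) yl); apply: nondecreasing_cvgn_le => //.
    by apply/cvg_ex; exists y.
  have [xE yE] := orbit_lim_fixed xpos y_ge0 xl yl.
  case: qE (hx 0%N) (hy 0%N) => /= q1 q2 hx0 hy0; apply: neq.
  rewrite [q]surjective_pairing; congr pair; apply/eqP; rewrite eq_le.
    by rewrite q1 -xE hx0.
  by rewrite q2 -yE hy0.
split; first by rewrite -x0.
apply/cvgryPge => A.
have A1 : 0 < Num.max A 1 by rewrite lt_max ltr01 orbT.
suff : \forall n \near \oo, A <= (iter n.+1 T q).2.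
  by move=> [N _ hN]; exists N.+1 => // -[//|n] /= Nn; exact: hN.
(* The next second coordinate is at least [B c^2 / x_n], which exceeds [A] once [x_n] is below this
   threshold; the maximum with 1 keeps the threshold positive. *)
have e0 : 0 < B * c ^+ 2 / Num.max A 1 by pos.
have /cvgrPdist_lt/(_ _ e0) := xl; apply: filterS => n.
have [xn0 yn0] := dn n.
rewrite x0 sub0r normrN gtr0_norm // => hn.
apply: (@le_trans _ _ (Num.max A 1)); first by rewrite le_max lexx.
rewrite iterS Tcrit2 ler_pdivlMr // mulrC -ler_pdivlMr //.
apply: (le_trans (ltW hn)); rewrite ler_pM2r ?invr_gt0 // lerDl.
by rewrite mulr_ge0 // ltW.
Qed.

(* [(k + c - e, B c + B e)] lies on the line where the first coordinate is
   stationary, tangent to the eigenspace for the eigenvalue 1. *)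
Lemma below_E_infty p : dom p -> lt_se p E -> asymptotic_0_infty T p.
Proof.
move=> dp [/= px py].
(* The largest [e] for which the point of this line still dominates [p]. *)
pose e := Num.min (k + c - p.1) ((p.2 - B * c) / B).
have e_gt0 : 0 < e by rewrite /e lt_min; apply/andP; split; pos.
have e1 : e <= k + c - p.1 by rewrite /e ge_min lexx.
have e2 : B * e <= p.2 - B * c.
  by rewrite mulrC -ler_pdivlMr // /e ge_min lexx orbT.
have [x0 y0] := dp.
pose q := (k + c - e, B * c + B * e).
have qx : 0 < q.1 by rewrite /q /=; lra.
have dq : dom q by split => //; rewrite /q /=; pos.
have pq : le_se p q by split; rewrite /q /=; lra.
have sq : B * q.1 + q.2 = B * (k + 2 * c) by rewrite /q /=; ring.
apply: (asymptotic_down dp dq pq); apply: decreasing_to_infty => //.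
- split; first by rewrite Tcrit1 sq mulrAC divff ?mul1r // gt_eqF //; pos.
  (* The terms of first order in [e] cancel, and the drift along the eigenvalue 1 has the sign of
     [B e^2]: it points North-West. *)
  rewrite Tcrit2 ler_pdivlMr // /q /= -subr_ge0.
  suff -> : B * c ^+ 2 + k * (B * c + B * e) -
    (B * c + B * e) * (k + c - e) = B * e ^+ 2 by pos.
  by ring.
- by split; rewrite /q /= ?gerBl ?lerDl; pos.
- by move=> [] /eqP; rewrite -subr_eq0 addrC addKr oppr_eq0 gt_eqF.
Qed.

Lemma below_E_infty_weak p : dom p -> le_se p E -> p <> E ->
  asymptotic_0_infty T p.
Proof.
move=> dp pE neq; apply: (asymptotic_iter (N := 2)).
have := Tcrit_strict_mono2 dp Ecrit_dom pE neq; rewrite !Tcrit_fixed.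
by apply: below_E_infty; do 2!apply: Tcrit_dom.
Qed.

(** The point [(M, 0)] dominates [p] for large [M]. Its image has first coordinate [k + 2 c]
    whatever [M] is, so its orbit decreases as soon as [M >= k + 2 c]. *)
Lemma above_bound p : dom p -> exists q, [/\ dom q, le_se p q & basin T E q].
Proof.
move=> [x0 y0].
have [M [M1 M2]] : exists M, p.1 <= M /\ k + 2 * c <= M.
  by exists (Num.max p.1 (k + 2 * c)); rewrite !le_max !lexx orbT.
have M0 : 0 < M by exact: lt_le_trans M1.
have dM : dom (M, 0) by split => /=.
exists (M, 0); split => //; apply: decreasing_to_E => //.
  split; last exact: ltW (Tcrit_pos dM).2.
  suff -> : (T (M, 0)).1 = k + 2 * c by [].
  by rewrite Tcrit1 /= addr0; field; rewrite !gt_eqF.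
split => /=; last by pos.
by apply: le_trans M2; rewrite lerD2l ler_peMl ?ler1n // ltW.
Qed.

(** The orbit is squeezed between the constant orbit [E] and that of a dominating point of the
    basin. *)
Lemma above_E_basin p : dom p -> le_se E p -> basin T E p.
Proof.
move=> dp Ep; have [q [dq pq /basinP[_ [qx qy]]]] := above_bound dp.
have hE n : le_se E (iter n T p).
  by have := iter_mono n Ecrit_dom dp Ep; rewrite iter_E.
apply/basinP; split => //; split.
  apply: squeeze_cvgr qx; last exact: cvg_cst.
  apply: nearW => n; rewrite (hE n).1 /=.
  exact: (iter_mono n dp dq pq).1.
apply: squeeze_cvgr qy _; last exact: cvg_cst.
apply: nearW => n; rewrite (hE n).2 andbT.
exact: (iter_mono n dp dq pq).2.
Qed.

(** Only an upper comparison orbit is available. It controls the first deviation when the iterate is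
    North-East of [E] and the second one when it is South-West; [cone_bounds] transfers the control
    to the other coordinate. *)
Lemma cone_orbit_basin p : dom p ->
  (forall n, 0 < ((iter n T p).1 - (k + c)) * ((iter n T p).2 - B * c)) ->
  basin T E p.
Proof.
move=> dp hp; have [q [dq pq /basinP[_ [qx qy]]]] := above_bound dp.
have cone n : B * c * `|(iter n T p).1 - (k + c)| <= (k + c) * `|(iter n T p).2 - B * c| /\
  k * `|(iter n T p).2 - B * c| <= B * c * `|(iter n T p).1 - (k + c)|.
  apply: cone_bounds => //; first exact: iter_dom.
  by apply/ltW; exact: (hp n.+1).
pose U n := `|(iter n T q).1 - (k + c)|; pose V n := `|(iter n T q).2 - B * c|.
have U0 : U @ \oo --> (0 : R).
  rewrite -(normr0 R); apply: cvg_norm; rewrite -(subrr (k + c)).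
  by apply: cvgB => //; exact: cvg_cst.
have V0 : V @ \oo --> (0 : R).
  rewrite -(normr0 R); apply: cvg_norm; rewrite -(subrr (B * c)).
  by apply: cvgB => //; exact: cvg_cst.
have bnd n : `|(iter n T p).1 - (k + c)| <= U n + (k + c) / (B * c) * V n /\
    `|(iter n T p).2 - B * c| <= V n + B * c / k * U n.
  have [pq1 pq2] := iter_mono n dp dq pq; have := hp n; have := cone n.
  rewrite /U /V.
  move: (iter n T p) (iter n T q) pq1 pq2 => [x y] [x' y'] /= xx yy [c1 c2] uv.
  have U0' := normr_ge0 (x' - (k + c)); have V0' := normr_ge0 (y' - B * c).
  have [h|h|h] := ltrgtP 0 (x - (k + c)); last by rewrite -h mul0r ltxx in uv.
    have xu : `|x - (k + c)| <= `|x' - (k + c)|.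
      by rewrite !gtr0_norm //; lra.
    split; first by rewrite (le_trans xu) // lerDl; pos.
    apply: (@le_trans _ _ (B * c / k * `|x' - (k + c)|)); last by rewrite lerDr.
    rewrite mulrAC ler_pdivlMr // mulrC (le_trans c2) // ler_pM2l //.
    by rewrite mulr_gt0.
  have v0 : y - B * c < 0 by rewrite nmulr_rgt0 in uv.
  have yv : `|y - B * c| <= `|y' - B * c|.
    by rewrite !ltr0_norm //; lra.
  split; last by rewrite (le_trans yv) // lerDl; pos.
  apply: (@le_trans _ _ ((k + c) / (B * c) * `|y' - B * c|)); last by rewrite lerDr.
  rewrite mulrAC ler_pdivlMr ?mulr_gt0 // mulrC (le_trans c1) // ler_pM2l //.
  by rewrite addr_gt0.
have lim0 (w : nat -> R) (l : R) (K L : R) (X Y : nat -> R) :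
    X @ \oo --> (0 : R) -> Y @ \oo --> (0 : R) ->
    (forall n, `|w n - l| <= X n + K * Y n) -> w @ \oo --> l.
  move=> X0 Y0 h; apply/cvgrPdist_le => e e0.
  have : (fun n => X n + K * Y n) @ \oo --> 0 + K * 0.
    by apply: cvgD => //; apply: cvgM => //; exact: cvg_cst.
  rewrite mulr0 addr0 => /cvgrPdist_le/(_ _ e0); apply: filterS => n.
  rewrite sub0r normrN distrC => hh; apply: (le_trans (h n)).
  exact: le_trans (ler_norm _) hh.
apply/basinP; split => //; split.
  by apply: (lim0 _ _ _ 0 _ _ U0 V0) => n; exact: (bnd n).1.
by apply: (lim0 _ _ _ 0 _ _ V0 U0) => n; exact: (bnd n).2.
Qed.

(** An orbit enters the closed North-West quadrant of [E], or the South-East one, or keeps two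
    deviations of the same strict sign forever; only the first case escapes the basin. The strict
    inequality reached at a finite time makes escape an open condition. *)
Lemma dichotomy p : dom p -> ~ basin T E p -> asymptotic_0_infty T p /\
  exists n, lt_se (iter n T p) E.
Proof.
move=> dp nb.
have [[N pE]|hN] := pselect (exists n, le_se (iter n T p) E).
  have dN := iter_dom N dp.
  have neq : iter N T p <> E.
    move=> pNE; apply: nb; apply/(basin_iter N dp); rewrite pNE.
    by apply: above_E_basin => //; exact: Ecrit_dom.
  split; first by apply: (asymptotic_iter (N := N)); exact: below_E_infty_weak.
  exists (2 + N)%N; rewrite iterD.
  by have := Tcrit_strict_mono2 dN Ecrit_dom pE neq; rewrite !Tcrit_fixed.
case: nb; have [[N Ep]|hE] := pselect (exists n, le_se E (iter n T p)).
  by apply/(basin_iter N dp); apply: above_E_basin => //; exact: iter_dom.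
apply: cone_orbit_basin => // n; rewrite ltNge; apply/negP => uv.
have [x0|x0] := leP (iter n T p).1 (k + c).
  have [y0|y0] := leP (B * c) (iter n T p).2; first by apply: hN; exists n.
  suff xe : (iter n T p).1 = k + c.
    by apply: hE; exists n; split => /=; rewrite ?xe // ltW.
  apply/eqP; rewrite eq_le x0 /= -subr_ge0 -(nmulr_lle0 _ (_ : (iter n T p).2 - B * c < 0)) //.
  by rewrite subr_lt0.
apply: hE; exists n; split => /=; first exact: ltW.
rewrite -subr_le0 -(pmulr_rle0 _ (_ : 0 < (iter n T p).1 - (k + c))) //.
by rewrite subr_gt0.
Qed.

(** If the orbit of [q] escaped, comparison would make the smaller orbit of [p] escape too. *)
Lemma basin_up p q : basin T E p -> dom q -> le_se p q -> basin T E q.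
Proof.
move=> bp dq pq; have [dp _] := bp; apply: contrapT => /(dichotomy dq)[aq _].
by apply: (basin_asymptotic bp); exact: (asymptotic_down dp dq pq).
Qed.

Lemma iter_cvg (S : Type) (F : set_system S) (FF : Filter F) (f : S -> R * R)
    q n : dom q ->
  (fun s => (f s).1) @ F --> q.1 -> (fun s => (f s).2) @ F --> q.2 ->
  (fun s => (iter n T (f s)).1) @ F --> (iter n T q).1 /\
  (fun s => (iter n T (f s)).2) @ F --> (iter n T q).2.
Proof.
move=> dq fx fy; elim: n => // n [IHx IHy]; have [x0 y0] := iter_dom n dq.
by have := Tcrit_cvg FF x0 y0 IHx IHy; rewrite -surjective_pairing.
Qed.

Lemma near_iter q n : dom q ->
  (fun p => (iter n T p).1) @ q --> (iter n T q).1 /\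
  (fun p => (iter n T p).2) @ q --> (iter n T q).2.
Proof.
move=> dq; apply: (@iter_cvg _ (nbhs q) _ id) => //; case: q dq => x y dq.
  exact: (@cvg_fst _ _ (nbhs x) (nbhs y)).
exact: (@cvg_snd _ _ (nbhs x) (nbhs y)).
Qed.

Lemma near_lt_se_r p q n : dom q -> lt_se p (iter n T q) ->
  \forall q' \near q, lt_se p (iter n T q').
Proof.
move=> dq [px py]; have [cx cy] := near_iter n dq.
have h1 : \forall q' \near q, p.1 < (iter n T q').1.
  exact: (cvgr_gt _ cx).
have h2 : \forall q' \near q, (iter n T q').2 < p.2.
  exact: (cvgr_lt _ cy).
by near=> q'; split; near: q'.
Unshelve. all: by end_near. Qed.

Lemma near_lt_se_l p q n : dom q -> lt_se (iter n T q) p ->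
  \forall q' \near q, lt_se (iter n T q') p.
Proof.
move=> dq [px py]; have [cx cy] := near_iter n dq.
have h1 : \forall q' \near q, (iter n T q').1 < p.1.
  exact: (cvgr_lt _ cx).
have h2 : \forall q' \near q, p.2 < (iter n T q').2.
  exact: (cvgr_gt _ cy).
by near=> q'; split; near: q'.
Unshelve. all: by end_near. Qed.

(** After two steps the order is strict in both coordinates, and it survives small perturbations of
    [q]. *)
Lemma basin_interior p q : basin T E p -> dom q -> le_se p q -> p <> q ->
  \forall q' \near q, dom q' -> basin T E q'.
Proof.
move=> bp dq pq neq; have [dp _] := bp.
have := near_lt_se_r (n := 2) dq (Tcrit_strict_mono2 dp dq pq neq).
apply: filterS => q' [h1 h2] dq'.
have b2 : basin T E (iter 2 T p) by apply/basin_iter.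
apply/(basin_iter 2 dq'); apply: (basin_up b2); first exact: iter_dom.
by split; exact: ltW.
Qed.

(** An escaping orbit is strictly North-West of [E] at some finite time, and so are the nearby
    orbits at that time. *)
Lemma basin_closed q : dom q -> ~ basin T E q ->
  \forall q' \near q, dom q' -> ~ basin T E q'.
Proof.
move=> dq /(dichotomy dq)[_ [n hn]].
apply: filterS (near_lt_se_l dq hn) => q' h dq' /(basin_iter n dq') b.
by apply: (basin_asymptotic b); apply: below_E_infty h; exact: iter_dom.
Qed.

Lemma basin_bounded (x : R) : 0 < x ->
  exists2 y : R, 0 <= y & ~ basin T E (x, y).
Proof.
move=> x0.
(* Large enough for [T (x, y)] to be strictly North-West of [E]: the second term brings the first
   coordinate below [k + c], the third one the second coordinate above [B c]. *)
pose y := 1 + B * (k + 2 * c) * x / (k + c) + (x * (B * c) / k).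
have y0 : 0 < y by rewrite /y; pos.
exists y; first exact: ltW.
have dp : dom (x, y) by split => //=; exact: ltW.
have lt : lt_se (T (x, y)) E.
  split; rewrite ?Tcrit1 ?Tcrit2 /=.
    rewrite ltr_pdivrMr; last by pos.
    rewrite [ltRHS]mulrC -ltr_pdivrMr; last by pos.
    rewrite ltr_wpDl; [by []|by pos|].
    by rewrite /y -addrA addrCA ltrDl; pos.
  rewrite ltr_pdivlMr // mulrC -subr_gt0.
  suff -> : B * c ^+ 2 + k * y - x * (B * c) =
    B * c ^+ 2 + k * (1 + B * (k + 2 * c) * x / (k + c)) by pos.
  by rewrite /y; field; rewrite !gt_eqF //; pos.
move=> /(basin_iter 1 dp) b; apply: (basin_asymptotic b).
by apply: below_E_infty => //; exact: Tcrit_dom.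
Qed.

Lemma basin_E : basin T E E.
Proof. by apply: above_E_basin; [exact: Ecrit_dom|exact: le_se_refl]. Qed.

(** * The boundary of the basin *)

Lemma near_box (P : R * R -> Prop) q : (\forall q' \near q, P q') ->
  exists2 e : R, 0 < e &
    forall x y, `|q.1 - x| < e -> `|q.2 - y| < e -> P (x, y).
Proof.
move=> /nbhs_ballP[e e0 he]; exists e => // x y hx hy.
by apply: he; split.
Qed.

Lemma basin_interior_box p q : basin T E p -> dom q -> le_se p q -> p <> q ->
  exists2 e : R, 0 < e &
    forall x y, `|q.1 - x| < e -> `|q.2 - y| < e -> dom (x, y) ->
      basin T E (x, y).
Proof.
by move=> bp dq pq neq; exact: near_box (basin_interior bp dq pq neq).
Qed.

Lemma basin_closed_box q : dom q -> ~ basin T E q ->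
  exists2 e : R, 0 < e &
    forall x y, `|q.1 - x| < e -> `|q.2 - y| < e -> dom (x, y) ->
      ~ basin T E (x, y).
Proof. by move=> dq nq; exact: near_box (basin_closed dq nq). Qed.

(** Lowering [y] moves up in the order, so a vertical fibre meets the basin exactly when its point
    on the axis belongs to it. *)
Definition base : set R := [set x | 0 < x /\ basin T E (x, 0)].

Definition height (x : R) : R := sup [set y | 0 <= y /\ basin T E (x, y)].

Definition curve : set (R * R) := graph_over base height.

Lemma basin_base p : basin T E p -> base p.1.
Proof.
move=> bp; have [x0 y0] := bp.1; split => //.
by apply: (basin_up bp); split => //=.
Qed.

Lemma base_up x x' : base x -> x <= x' -> base x'.
Proof.
move=> [x0 bx] xx'; have x0' := lt_le_trans x0 xx'.
by split => //; apply: (basin_up bx); split.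
Qed.

Lemma height_sup x : base x -> has_sup [set y | 0 <= y /\ basin T E (x, y)].
Proof.
move=> [x0 bx]; split; first by exists 0.
have [y y0 ny] := basin_bounded x0; exists y => z [z0 bz].
rewrite leNgt; apply/negP => yz; apply: ny.
by apply: (basin_up bz); split => //=; exact: ltW.
Qed.

Lemma height_ge0 x : base x -> 0 <= height x.
Proof.
by move=> bx; apply: (sup_upper_bound (height_sup bx)); split => //; case: bx.
Qed.

(** By monotonicity a fibre of the basin contains every lower [y >= 0]; it contains its supremum
    because the basin is closed in the domain. *)
Lemma heightP x y : base x -> 0 <= y -> basin T E (x, y) <-> y <= height x.
Proof.
move=> bx y0; split.
  by move=> bxy; apply: (sup_upper_bound (height_sup bx)).
move=> yh; have dxy : dom (x, y) by case: bx.
apply: contrapT => /(basin_closed_box dxy)[e e0 he].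
have [z [z0 bz] hz] := sup_adherent e0 (height_sup bx).
have [yz|zy] := leP y z.
  have : ~ basin T E (x, y).
    by apply: he; rewrite /= ?subrr ?normr0.
  by apply; apply: (basin_up bz dxy); split.
apply: (he x z) => //=; first by rewrite subrr normr0.
  by rewrite gtr0_norm ?subr_gt0 // /height in yh hz *; lra.
by case: bx.
Qed.

Lemma curve_basin p : curve p -> basin T E p.
Proof.
case: p => x y [/= bx ->]; apply/heightP => //; exact: height_ge0.
Qed.

(* By strong monotonicity a point strictly south-east of a basin point is
   interior to the basin, whereas points of the curve are not. *)
Lemma curve_antichain p q : basin T E p -> curve q -> le_se p q -> p = q.
Proof.
move=> bp cq pq; apply: contrapT => neq.
have [dq0 _] := curve_basin cq.
have [e e0 he] := basin_interior_box bp dq0 pq neq.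
case: q cq dq0 {pq neq} he => x y [/= bx ->] [/= x0 y0] he.
have e2 : 0 < e / 2 by rewrite divr_gt0.
suff /heightP : basin T E (x, height x + e / 2).
  move=> /(_ bx (addr_ge0 y0 (ltW e2))); lra.
apply: he => /=; rewrite ?subrr ?normr0 //.
  by rewrite opprD addNKr normrN gtr0_norm //; lra.
by split => //=; lra.
Qed.

Lemma curve_below p : basin T E p -> ~ curve p ->
  exists q, [/\ curve q, le_se q p & q <> p].
Proof.
move=> bp ncp; have bx := basin_base bp.
exists (p.1, height p.1); split => //.
  split => //=; apply/(heightP bx bp.1.2); by rewrite -surjective_pairing.
by move=> eq; apply: ncp; rewrite -eq.
Qed.

(** Otherwise some point of the curve, distinct from [E], would precede [E] in the order, and its
    orbit would escape. *)
Lemma curve_E : curve E.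
Proof.
apply: contrapT => /(curve_below basin_E)[q [cq qE neq]].
apply: (basin_asymptotic (curve_basin cq)).
by apply: below_E_infty_weak => //; case: (curve_basin cq).
Qed.

Lemma height_increasing x x' : base x -> base x' -> x < x' ->
  height x < height x'.
Proof.
move=> bx bx' xx'; rewrite ltNge; apply/negP => hh.
have cx : curve (x, height x) by [].
have cx' : curve (x', height x') by [].
have [/eqP] := curve_antichain (curve_basin cx) cx' (conj (ltW xx') hh).
by rewrite lt_eqF.
Qed.

(** The upper estimate holds because [(x, height x + e)] is outside the basin, which is closed in
    the domain; the lower one because [(x, height x - e)], strictly above a curve point in the
    order, is interior to the basin. *)
Lemma height_continuous : {within base, continuous height}.
Proof.
apply/subspace_continuousP => x bx; apply/cvgrPdist_le => /= e e0.
have h0 := height_ge0 bx; have x0 := bx.1.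
have cx : curve (x, height x) by [].
have du : dom (x, height x + e) by split => //=; lra.
have nu : ~ basin T E (x, height x + e).
  by move=> /(heightP bx (addr_ge0 h0 (ltW e0))); lra.
have [d1 d10 hd1] := basin_closed_box du nu.
have [d2 d20 hd2] : exists2 d : R, 0 < d &
    forall z, base z -> `|x - z| < d -> height x - e <= height z.
  have [he|he] := ltP (height x - e) 0.
    by exists 1 => // z bz _; have := height_ge0 bz; lra.
  have dl : dom (x, height x - e) by split.
  have [||d d0 hd] := basin_interior_box (curve_basin cx) dl.
  - by split => //=; lra.
  - by case=> /eqP; rewrite -subr_eq0 opprB addrC subrK gt_eqF.
  exists d => // z bz xz; apply/heightP => //; apply: hd => //=.
    by rewrite subrr normr0.
  by split => //; case: bz.
rewrite near_withinE; apply/nbhs_ballP.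
exists (Num.min d1 d2) => /=; first by rewrite lt_min d10.
move=> z; rewrite /ball /= lt_min => /andP[z1 z2] bz.
rewrite ler_distl; apply/andP; split; last first.
  by rewrite -lerBlDr; exact: hd2.
rewrite lerBlDr leNgt; apply/negP => hz; apply: (hd1 z (height x + e)) => //=.
- by rewrite subrr normr0.
- by split; [exact: bz.1|exact: addr_ge0 h0 (ltW e0)].
apply/(heightP bz); [exact: addr_ge0 h0 (ltW e0)|exact: ltW].
Qed.

Lemma curve_increasing_on : increasing_on base height.
Proof.
split.
- move=> x y bx by_ z /andP[xz _]; exact: base_up bx xz.
- exists (k + c + 1); exists 1 => //= z /=.
  rewrite /ball /= ltr_norml => /andP[_ hz].
  by apply: (@base_up (k + c)); [exact: (basin_base basin_E)|lra].
- exact: height_continuous.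
- exact: height_increasing.
Qed.

(** If [T p] were strictly above a curve point [q], two more steps would make the order strict.
    Raising the second coordinate of [p] slightly would then keep its third iterate above
    [iter 2 T q], so the raised point would still be in the basin, past the top of its fibre. *)
Lemma curve_invariant p : curve p -> curve (T p).
Proof.
move=> cp; have [dp bp] := curve_basin cp.
have bTp : basin T E (T p) by apply/(basin_iter 1 dp); exact: curve_basin.
apply: contrapT => /(curve_below bTp)[q [cq qTp neq]].
have [dq _] := curve_basin cq.
have lt : lt_se (iter 2 T q) (iter 3 T p).
  by have := Tcrit_strict_mono2 dq bTp.1 qTp neq.
have bq2 : basin T E (iter 2 T q) by apply/(basin_iter 2 dq); exact: curve_basin.
have [e e0 he] := near_box (near_lt_se_r dp lt).
have [e2 e02] : 0 < e / 2 /\ e / 2 < e by split; lra.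
have d' : dom (p.1, p.2 + e / 2).
  by case: dp => ? ?; split => //=; lra.
have b' : basin T E (p.1, p.2 + e / 2).
  apply/(basin_iter 3 d'); apply: (basin_up bq2); first exact: iter_dom.
  have [] := he p.1 (p.2 + e / 2); rewrite ?subrr ?normr0 //.
    by rewrite opprD addNKr normrN gtr0_norm.
  by move=> h1 h2; split; exact: ltW.
have le : le_se (p.1, p.2 + e / 2) p by split => //=; lra.
have := congr1 snd (curve_antichain b' cp le) => /= /eqP.
by rewrite -subr_eq0 addrC addKr gt_eqF.
Qed.

Lemma curve_iter p n : curve p -> curve (iter n T p).
Proof. by move=> cp; elim: n => //= n; exact: curve_invariant. Qed.

Lemma WplusE : Wplus curve = basin T E `\` curve.
Proof.
apply/seteqP; split => p.
  move=> [[dp ncp] [q cq qp]]; split => //.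
  exact: basin_up (curve_basin cq) dp qp.
move=> [bp ncp]; split; first by split => //; case: bp.
by have [q [cq qp _]] := curve_below bp ncp; exists q.
Qed.

(** The infimum [a] of the base belongs to it by closedness. Its height is 0, since otherwise
    [(a, 0)] would be interior to the basin and the base would extend to the left of [a]. Thus
    domain points to the left of the base also have a curve point above them. *)
Lemma base_min x : 0 < x -> ~ base x ->
  exists2 a : R, x < a & curve (a, 0).
Proof.
move=> x0 nbx.
have lbx : lbound base x.
  move=> z bz; rewrite leNgt; apply/negP => zx; apply: nbx.
  by apply: base_up bz _; exact: ltW.
have bE : base (k + c) by exact: (basin_base basin_E).
have hi : has_inf base by split; [exists (k + c)|exists x].
pose a := inf base.
have ax : x <= a by apply: lb_le_inf => //; exists (k + c).
have a0 : 0 < a by exact: lt_le_trans ax.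
have da : dom (a, 0) by split => /=.
have ba : base a.
  split => //; apply: contrapT => /(basin_closed_box da)[e e0 he].
  have [z bz za] := inf_adherent e0 hi.
  have az : a <= z by apply: ge_inf => //; exists x.
  apply: (he z 0) => //=; rewrite ?subrr ?normr0 //; last exact: bz.2.
    by rewrite distrC ger0_norm ?subr_ge0 // ltrBlDl.
  by split => //=; case: bz.
exists a.
  rewrite lt_neqAle ax andbT; apply/eqP => xa; apply: nbx; by rewrite xa.
split => //=; apply/eqP; rewrite eq_le height_ge0 //= leNgt; apply/negP => h0.
have ca : curve (a, height a) by [].
have [||e e0 he] := basin_interior_box (curve_basin ca) da.
- by split => //=; exact: ltW.
- by case=> /eqP; rewrite gt_eqF.
pose d := Num.min (e / 2) (a / 2).
have d0 : 0 < d by rewrite lt_min !divr_gt0.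
have de : d < e by apply: (@le_lt_trans _ _ (e / 2)); [rewrite ge_min lexx|lra].
have dlta : d < a.
  by apply: (@le_lt_trans _ _ (a / 2)); [rewrite ge_min lexx orbT|lra].
have : base (a - d).
  split; first by rewrite subr_gt0.
  apply: he => /=; rewrite ?subrr ?normr0 //.
    by rewrite opprB addrC subrK gtr0_norm.
  by split => //=; rewrite subr_gt0.
by move=> /(ge_inf hi.2); rewrite -/a; lra.
Qed.

Lemma WminusE : Wminus curve = dom `\` basin T E.
Proof.
apply/seteqP; split => p.
  move=> [[dp ncp] [q cq pq]]; split => // bp; apply: ncp.
  by rewrite (curve_antichain bp cq pq).
move=> [dp nbp]; split; first by split => // /curve_basin.
have [bx|nbx] := pselect (base p.1).
  exists (p.1, height p.1) => //; split => //=.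
  rewrite leNgt; apply/negP => hp; apply: nbp.
  rewrite [p]surjective_pairing; apply/(heightP bx dp.2); exact: ltW.
have [a pa ca] := base_min dp.1 nbx.
by exists (a, 0) => //; split; [exact: ltW|case: dp].
Qed.

(** * Connectedness and separation of the two sides of the curve *)

Lemma dom_segment p q t : dom p -> dom q -> 0 <= t <= 1 ->
  dom (p.1 + t * (q.1 - p.1), p.2 + t * (q.2 - p.2)).
Proof.
move=> [p1 p2] [q1 q2] /andP[t0 t1]; split => /=; last by nra.
have -> : p.1 + t * (q.1 - p.1) = (1 - t) * p.1 + t * q.1 by ring.
have [->|t0'] := eqVneq t 0; first by rewrite subr0 mul1r mul0r addr0.
have {t0 t0'}t0 : 0 < t by rewrite lt0r t0'.
by apply: ltr_wpDl; pos.
Qed.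

(** Every point is joined to a fixed [p0] by two segments through a common point [m]; [A] is the
    union of these paths. *)
Lemma segments_connected (A : set (R * R)) :
  (forall p q, A p -> A q -> exists2 m, A m &
    forall t, 0 <= t <= 1 ->
      A (p.1 + t * (m.1 - p.1), p.2 + t * (m.2 - p.2)) /\
      A (q.1 + t * (m.1 - q.1), q.2 + t * (m.2 - q.2))) ->
  connected A.
Proof.
move=> hA; have [->|/set0P[p0 Ap0]] := eqVneq A set0; first exact: connected0.
pose seg p q := [set ((p.1 + t * (q.1 - p.1), p.2 + t * (q.2 - p.2)) : R * R) | t in `[0, 1]%classic].
have seg_conn p q : connected (seg p q).
  apply: connected_continuous_connected; first exact: segment_connected.
  apply: continuous_subspaceT => t.
  have aff (u v : R) : (fun s : R => u + s * v) @ t --> u + t * v.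
    apply: cvgD; first exact: cvg_cst.
    by apply: cvgM; [exact: cvg_id|exact: cvg_cst].
  exact: (cvg_pair (aff _ _) (aff _ _)).
have seg0 p q : seg p q p.
  by exists 0; rewrite /= ?in_itv /= ?lexx ?ler01 // !mul0r !addr0 -surjective_pairing.
have seg1 p q : seg p q q.
  exists 1; rewrite /= ?in_itv /= ?lexx ?ler01 // !mul1r.
  by rewrite [RHS]surjective_pairing; congr pair; rewrite addrC subrK.
have hK p : exists K : set (R * R), A p ->
    [/\ connected K, K `<=` A, K p & K p0].
  have [Ap|] := pselect (A p); last by exists set0.
  have [m Am hm] := hA p p0 Ap Ap0.
  exists (seg p m `|` seg p0 m) => _; split.
  - by apply: connectedU => //; exists m; split.
  - by move=> _ [] [t /= t01 <-]; rewrite in_itv /= in t01; case: (hm t t01).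
  - by left.
  - by right.
have [K hKA] := choice hK.
have -> : A = \bigcup_(p in A) K p.
  apply/seteqP; split => p; first by move=> Ap; exists p => //; case: (hKA p Ap).
  by move=> [q Aq Kp]; have [_ + _ _] := hKA q Aq; apply.
apply: bigcup_connected; first by exists p0 => p Ap; case: (hKA p Ap).
by move=> p Ap; case: (hKA p Ap).
Qed.

(** The meeting point is the least upper bound of [p] and [q] for the South-East order; a segment
    going up to it stays above its starting point. *)
Lemma up_connected (A : set (R * R)) : A `<=` dom ->
  (forall p q, A p -> dom q -> le_se p q -> A q) -> connected A.
Proof.
move=> Adom Aup; apply: segments_connected => p q Ap Aq.
pose m := (Num.max p.1 q.1, Num.min p.2 q.2).
have pm : le_se p m by split; rewrite /m /= ?le_max ?ge_min lexx.
have qm : le_se q m by split; rewrite /m /= ?le_max ?ge_min lexx orbT.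
have dm : dom m.
  have [? ?] := Adom p Ap; have [? ?] := Adom q Aq.
  by split; rewrite /m /= ?lt_max ?le_min; apply/orP || apply/andP; tauto.
exists m; first exact: Aup Ap dm pm.
have seg z : A z -> le_se z m -> forall t, 0 <= t <= 1 ->
    A (z.1 + t * (m.1 - z.1), z.2 + t * (m.2 - z.2)).
  move=> Az [z1 z2] t t01; apply: (Aup _ _ Az).
    by apply: dom_segment => //; exact: Adom.
  case/andP: t01 => t0 t1; split => /=; first by rewrite lerDl; pos.
  by rewrite gerDl mulr_ge0_le0 // subr_le0.
by move=> t t01; split; exact: seg.
Qed.

Lemma down_connected (A : set (R * R)) : A `<=` dom ->
  (forall p q, A p -> dom q -> le_se q p -> A q) -> connected A.
Proof.
move=> Adom Adown; apply: segments_connected => p q Ap Aq.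
pose m := (Num.min p.1 q.1, Num.max p.2 q.2).
have pm : le_se m p by split; rewrite /m /= ?le_max ?ge_min lexx.
have qm : le_se m q by split; rewrite /m /= ?le_max ?ge_min lexx orbT.
have dm : dom m.
  have [? ?] := Adom p Ap; have [? ?] := Adom q Aq.
  by split; rewrite /m /= ?lt_min ?le_max; apply/orP || apply/andP; tauto.
exists m; first exact: Adown Ap dm pm.
have seg z : A z -> le_se m z -> forall t, 0 <= t <= 1 ->
    A (z.1 + t * (m.1 - z.1), z.2 + t * (m.2 - z.2)).
  move=> Az [z1 z2] t t01; apply: (Adown _ _ Az).
    by apply: dom_segment => //; exact: Adom.
  case/andP: t01 => t0 t1; split => /=; last by rewrite lerDl; pos.
  by rewrite gerDl mulr_ge0_le0 // subr_le0.
by move=> t t01; split; exact: seg.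
Qed.

Lemma curve_separates : separates curve.
Proof.
rewrite /separates WplusE WminusE; split.
- apply/seteqP; split => p.
    by move=> [dp ncp]; have [bp|nbp] := pselect (basin T E p); [right|left].
  by move=> [[dp nbp]|[[dp bp] ncp]]; split => // /curve_basin.
(* A basin point off the curve is strictly above a curve point, hence interior to the basin;
   conversely, points outside the basin form an open subset of the domain. *)
- split; apply/seteqP; split => // p.
    move=> [cl [bp ncp]].
    have [q [cq qp neq]] := curve_below bp ncp.
    have := basin_interior (curve_basin cq) bp.1 qp neq.
    by move=> /cl[q' [[dq' nbq'] /(_ dq')]].
  move=> [[dp nbp] cl].
  by have /cl[q' [[bq' _] /(_ bq'.1)]] := basin_closed dp nbp.
- have dE := Ecrit_dom; have := curve_E; split.
    exists (k + c, B * c + 1).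
    have d : dom (k + c, B * c + 1).
      by case: dE => ? /= ?; split => //=; apply: addr_ge0.
    have le : le_se (k + c, B * c + 1) E by split => //=; rewrite lerDl.
    split => // b; have [/eqP] := curve_antichain b curve_E le.
    by rewrite -subr_eq0 addrC addKr oner_eq0.
  exists (k + c + 1, B * c).
  have d : dom (k + c + 1, B * c).
    by case: dE => /= ? ?; split => //=; apply: addr_gt0.
  have le : le_se E (k + c + 1, B * c) by split => //=; rewrite lerDl.
  split; first exact: basin_up basin_E d le.
  move=> cq; have [/eqP] := curve_antichain basin_E cq le.
  by rewrite -subr_eq0 opprD addNKr oppr_eq0 oner_eq0.
- apply: down_connected; first by move=> p [].
  by move=> p q [dp nbp] dq qp; split => // bq; apply: nbp; exact: basin_up bq dp qp.
- apply: up_connected; first by move=> p [[]].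
  move=> p q [bp ncp] dq pq; split; first exact: basin_up bp dq pq.
  by move=> cq; apply: ncp; rewrite (curve_antichain bp cq pq).
Qed.

(** A limit [p] of curve points interior to the domain has [p.2 > 0] and lies in the basin by
    closedness. Then [(p.1, 0)] is strictly above [p] in the order, hence interior to the basin,
    which makes [p.1] interior to the base. *)
Lemma curve_no_endpoint : curve_endpoint curve `&` dom° = set0.
Proof.
apply/seteqP; split => // p [[clp [_ nint]] dp].
have dp' : dom p by exact: interior_subset dp.
have p2 : 0 < p.2.
  have [e e0 he] := near_box dp.
  have e2 : 0 < e / 2 by rewrite divr_gt0.
  have [] := he p.1 (p.2 - e / 2); rewrite ?subrr ?normr0 //; last first.
    by move=> _ /= h; rewrite (lt_le_trans e2) // -subr_ge0.
  by rewrite opprB addrC subrK gtr0_norm //; lra.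
have bp : basin T E p.
  apply: contrapT => /(basin_closed dp')/clp[q [cq /(_ (curve_basin cq).1)]].
  by apply; exact: curve_basin.
have d0 : dom (p.1, 0) by case: dp'.
have [||e e0 he] := basin_interior_box bp d0.
- by split => //=; exact: ltW.
- by rewrite [p]surjective_pairing => -[/eqP]; rewrite gt_eqF.
apply: nint; apply/nbhs_ballP; exists (Num.min e p.1) => /=.
  by rewrite lt_min e0; case: dp'.
move=> z; rewrite /ball /= lt_min => /andP[z1 z2].
have z0 : 0 < z by rewrite ltr_norml in z2; lra.
have bz : basin T E (z, 0).
  by apply: he => //=; rewrite subrr normr0.
exists (z, height z) => //; split => //=.
Qed.

(** * Tangency and uniqueness *)

(** The open North-East and South-West quadrants of [E], with [E] added: an increasing graph through
    [E] lies there. *)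
Definition diag p := p = E \/ 0 < (p.1 - (k + c)) * (p.2 - B * c).

Lemma increasing_graph_diag (I : set R) f p : increasing_on I f ->
  graph_over I f E -> graph_over I f p -> diag p.
Proof.
case: p => x y [_ _ _ inc] [/= IE fE] [/= Ix ->].
have [xE|xE|xE] := ltrgtP x (k + c).
- by right; rewrite /= fE nmulr_rgt0 subr_lt0 //; exact: inc.
- by right; rewrite /= fE pmulr_rgt0 subr_gt0 //; exact: inc.
- by left; rewrite xE -fE.
Qed.

Lemma diag_cone p : dom p -> diag p -> diag (T p) ->
  B * c * `|p.1 - (k + c)| <= (k + c) * `|p.2 - B * c| /\
  k * `|p.2 - B * c| <= B * c * `|p.1 - (k + c)|.
Proof.
move=> dp [->|dgp] dgTp; first by rewrite /= !subrr normr0 !mulr0.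
apply: cone_bounds => //.
by case: dgTp => [->|/ltW//]; rewrite /= subrr mul0r.
Qed.

(** The cone bounds fix the signs of the numerators in the deviation identities, so the absolute
    values also obey linear relations. *)
Lemma diag_norms p : dom p -> diag p -> diag (T p) ->
  `|(T p).1 - (k + c)| * (B * p.1 + p.2) =
    (k + c) * `|p.2 - B * c| - B * c * `|p.1 - (k + c)| /\
  `|(T p).2 - B * c| * p.1 =
    B * c * `|p.1 - (k + c)| - k * `|p.2 - B * c|.
Proof.
move=> dp dgp dgTp; have [] := diag_cone dp dgp dgTp.
have s0 := dom_sum_gt0 dp; have [x0 _] := dp.
rewrite -[in X in _ -> _ -> X = _ /\ _](gtr0_norm s0).
rewrite -[in X in _ -> _ -> _ /\ X = _](gtr0_norm x0).
rewrite -!normrM Tcrit_dev1 // Tcrit_dev2 //.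
case: dgp => [->|]; first by rewrite /= !subrr !(mulr0, normr0, subr0).
move: (p.1 - _) (p.2 - _) => u v uv.
have [u0|u0|u0] := ltrgtP u 0; last by rewrite u0 mul0r ltxx in uv.
  have v0 : v < 0 by rewrite nmulr_rgt0 in uv.
  rewrite (ltr0_norm u0) (ltr0_norm v0) => h1 h2.
  by split; rewrite ger0_norm; lra.
have v0 : 0 < v by rewrite pmulr_rgt0 in uv.
rewrite (gtr0_norm u0) (gtr0_norm v0) => h1 h2.
by split; rewrite ler0_norm; lra.
Qed.

Lemma diag_contraction p : dom p -> diag p -> diag (T p) -> diag (T (T p)) ->
  c <= p.1 -> `|(T p).1 - (k + c)| <= c / (k + c) * `|p.1 - (k + c)|.
Proof.
move=> dp dgp dgTp dgTTp cx.
have [e1 e2] := diag_norms dp dgp dgTp.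
have [le1 _] := diag_cone (Tcrit_dom dp) dgTp dgTTp.
have [x0 y0] := dp.
move: e1 e2 le1.
have := normr_ge0 ((T p).1 - (k + c)); have := normr_ge0 ((T p).2 - B * c).
move: `|(T p).1 - _| `|(T p).2 - _| `|p.1 - _| `|p.2 - _| => U' V' U V.
move=> V'0 U'0 e1 e2 le1.
have h1 : U' * (k * (B * p.1 + p.2) + B * c * p.1) <= B * c ^+ 2 * U.
  (* This combination of the two identities eliminates [V]; the cone bound at [T p] then replaces
     [V'] by [U']. *)
  have -> : B * c ^+ 2 * U = k * (U' * (B * p.1 + p.2)) + (k + c) * (V' * p.1).
    by rewrite e1 e2; ring.
  rewrite -subr_ge0.
  suff -> : k * (U' * (B * p.1 + p.2)) + (k + c) * (V' * p.1) -
     U' * (k * (B * p.1 + p.2) + B * c * p.1) =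
     p.1 * ((k + c) * V' - B * c * U') by pos.
  by ring.
(* The hypothesis [c <= p.1] bounds the coefficient of [U'] from below. *)
have h2 : U' * (B * c * (k + c)) <= B * c ^+ 2 * U.
  apply: le_trans h1; rewrite ler_wpM2l // -subr_ge0.
  suff -> : k * (B * p.1 + p.2) + B * c * p.1 - B * c * (k + c) =
    B * (k + c) * (p.1 - c) + k * p.2 by pos.
  by ring.
rewrite mulrAC ler_pdivlMr; last by pos.
rewrite -(ler_pM2l (_ : 0 < B * c)); last by pos.
apply: le_trans (le_trans h2 _); last by rewrite le_eqVlt; apply/orP; left; apply/eqP; ring.
by rewrite le_eqVlt; apply/orP; left; apply/eqP; ring.
Qed.

(** Slope of the eigenvector [(1, slope)] of the linearization for the eigenvalue [lambda2]. *)
Definition slope : R := B * c * (k + 2 * c) / (k + c) ^+ 2.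

Lemma slope_gt0 : 0 < slope.
Proof. by rewrite /slope; pos. Qed.

(* The component of [p - E] along the eigenvalue 1: the linearization
   preserves it. *)
Definition defect p := p.2 - B * c - slope * (p.1 - (k + c)).

(** An exact identity: the two correction terms are products of two deviations, hence quadratic. *)
Lemma defect_step p : dom p ->
  defect p = defect (T p) + ((T p).2 - B * c) * (p.1 - (k + c)) / (k + c)
   - slope * ((T p).1 - (k + c)) * (B * (p.1 - (k + c)) + (p.2 - B * c)) /
     (B * (k + 2 * c)).
Proof.
move=> dp; have := Tcrit_dev1 dp; have := Tcrit_dev2 dp; rewrite /defect.
move: (T p) => [x' y'] /=; case: p {dp} => x y /= e2 e1.
have -> : y' - B * c - slope * (x' - (k + c)) +
    (y' - B * c) * (x - (k + c)) / (k + c) -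
    slope * (x' - (k + c)) * (B * (x - (k + c)) + (y - B * c)) / (B * (k + 2 * c))
  = ((y' - B * c) * x) / (k + c) -
    slope * ((x' - (k + c)) * (B * x + y)) / (B * (k + 2 * c)).
  by field; rewrite !gt_eqF //; pos.
rewrite e1 e2 /slope; field.
by rewrite !gt_eqF //; pos.
Qed.

(** Bound for the quadratic corrections, obtained from the cone bounds and from the contraction of
    the first deviation. *)
Definition defect_const : R :=
  B * c / k / (k + c) + slope * (B + B * c / k) / (B * (k + 2 * c)).

Lemma defect_const_gt0 : 0 < defect_const.
Proof. have := slope_gt0; rewrite /defect_const => s0; pos. Qed.

Lemma curve_diag p : curve p -> diag p.
Proof.
by move=> cp; exact: increasing_graph_diag curve_increasing_on curve_E cp.
Qed.

Lemma diag_defect_step p : dom p -> diag p -> diag (T p) -> diag (T (T p)) ->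
  c <= p.1 ->
  `|defect p| <= `|defect (T p)| + defect_const * `|p.1 - (k + c)| ^+ 2.
Proof.
move=> dp dgp dgTp dgTTp cx.
have ct := diag_contraction dp dgp dgTp dgTTp cx.
have [_ v1] := diag_cone dp dgp dgTp.
have [_ v2] := diag_cone (Tcrit_dom dp) dgTp dgTTp.
rewrite (defect_step dp) /defect_const.
move: (defect (T p)) slope slope_gt0 => D s s0.
have U0 := normr_ge0 (p.1 - (k + c)).
have ct' : `|(T p).1 - (k + c)| <= `|p.1 - (k + c)|.
  apply: (le_trans ct); rewrite ler_piMl // ler_pdivrMr; last by pos.
  by rewrite mul1r lerDr ltW.
have vu : `|p.2 - B * c| <= B * c / k * `|p.1 - (k + c)|.
  by rewrite mulrAC ler_pdivlMr // mulrC.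
have vu' : `|(T p).2 - B * c| <= B * c / k * `|p.1 - (k + c)|.
  rewrite mulrAC ler_pdivlMr // mulrC (le_trans v2) // ler_pM2l //.
  by rewrite mulr_gt0.
rewrite -addrA; apply: (le_trans (ler_normD _ _)); rewrite lerD2l.
apply: (le_trans (ler_normB _ _)).
rewrite !normrM !normfV.
have kc0 : 0 < k + c by pos.
have bk0 : 0 < B * (k + 2 * c) by pos.
rewrite (gtr0_norm s0) (gtr0_norm kc0) (gtr0_norm bk0).
have sum : `|B * (p.1 - (k + c)) + (p.2 - B * c)| <= (B + B * c / k) * `|p.1 - (k + c)|.
  apply: (le_trans (ler_normD _ _)); rewrite normrM (gtr0_norm B_gt0) mulrDl.
  by rewrite lerD2l.
move: (normr_ge0 ((T p).2 - B * c)) (normr_ge0 ((T p).1 - (k + c)))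
  (normr_ge0 (B * (p.1 - (k + c)) + (p.2 - B * c))) sum vu' ct' U0.
move: `|(T p).2 - _| `|(T p).1 - _| `|B * _ + _| `|p.1 - _| => V' U' S U.
move=> V'0 U'0 S0 hS hV hU U0.
rewrite (mulrDl _ _ (U ^+ 2)); apply: lerD.
  have -> : B * c / k / (k + c) * U ^+ 2 = (B * c / k * U) * U / (k + c) by ring.
  by rewrite ler_pM2r ?invr_gt0 // ler_wpM2r.
have -> : s * (B + B * c / k) / (B * (k + 2 * c)) * U ^+ 2 =
  s * U * ((B + B * c / k) * U) / (B * (k + 2 * c)) by ring.
rewrite ler_pM2r ?invr_gt0 //; apply: ler_pM => //; first by pos.
by rewrite ler_pM2l.
Qed.

(** Corrections are summed along the orbit: the first term dominates the accumulated corrections,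
    the second one is a crude bound for the defect of the [n]-th iterate. The condition on the
    deviation gives [c <= p.1], as the contraction requires, and persists along the orbit. *)
Lemma defect_bound_iter n p : curve p -> `|p.1 - (k + c)| <= k ->
  `|defect p| <= defect_const * (k + c) / k * `|p.1 - (k + c)| ^+ 2 +
     (B * c / k + slope) * (c / (k + c)) ^+ n * `|p.1 - (k + c)|.
Proof.
have s0 := slope_gt0; have d0 := defect_const_gt0.
elim: n p => [|n IH] p cp uk; have [dp _] := curve_basin cp;
  have dg0 := curve_diag cp; have cTp := curve_invariant cp;
  have dg1 := curve_diag cTp; have dg2 := curve_diag (curve_invariant cTp);
  have U0 := normr_ge0 (p.1 - (k + c)).
  rewrite expr0 mulr1 ler_wpDl //; first by pos.
  rewrite /defect (le_trans (ler_normB _ _)) // mulrDl normrM (gtr0_norm s0) lerD2r.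
  have [_ v1] := diag_cone dp dg0 dg1.
  by rewrite mulrAC ler_pdivlMr // mulrC.
have cx : c <= p.1.
  by have := lerNnormlW uk; lra.
have ct := diag_contraction dp dg0 dg1 dg2 cx.
apply: (le_trans (diag_defect_step dp dg0 dg1 dg2 cx)).
have r1 : c / (k + c) <= 1 by rewrite ler_pdivrMr ?mul1r ?lerDr ?ltW //; pos.
have r0 : 0 <= c / (k + c) by pos.
have kE : `|(T p).1 - (k + c)| <= k.
  by apply: (le_trans ct); apply: le_trans uk; rewrite ler_piMl.
have {}IH := IH _ cTp kE.
rewrite (le_trans (lerD IH (lexx _))) //.
move: (normr_ge0 ((T p).1 - (k + c))) ct U0.
move: `|(T p).1 - _| `|p.1 - _| (exprn_ge0 n r0) => U' U rn0 U'0 ct U0.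
(* The factor [(k + c) / k] is the sum of the geometric series of ratio [c / (k + c)]. *)
have -> : defect_const * (k + c) / k * U ^+ 2 =
    defect_const * (k + c) / k * (c / (k + c) * U ^+ 2) + defect_const * U ^+ 2.
  by field; rewrite !gt_eqF //; pos.
rewrite addrAC lerD ?lerD2r //.
  rewrite ler_pM2l; last by pos.
  apply: (@le_trans _ _ ((c / (k + c) * U) * U)); last by rewrite -mulrA -expr2.
  rewrite expr2 ler_pM // (le_trans ct) // ler_piMl //.
rewrite exprSr mulrA -(mulrA _ (c / (k + c))) ler_wpM2l //.
by pos.
Qed.

Lemma geometric_le0 (a b r : R) : 0 <= r < 1 -> (forall n, a <= b * r ^+ n) -> a <= 0.
Proof.
move=> /andP[r0 r1] h.
have lim : (fun n => b * r ^+ n) @ \oo --> b * 0.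
  by apply: cvgM; [exact: cvg_cst|apply: cvg_expr; rewrite ger0_norm].
by rewrite mulr0 in lim; exact: seq_lim_ge lim h.
Qed.

Lemma defect_bound p : curve p -> `|p.1 - (k + c)| <= k ->
  `|defect p| <= defect_const * (k + c) / k * `|p.1 - (k + c)| ^+ 2.
Proof.
move=> cp uk; rewrite -subr_le0.
apply: (@geometric_le0 _ ((B * c / k + slope) * `|p.1 - (k + c)|) (c / (k + c))).
  apply/andP; split; first by pos.
  by rewrite ltr_pdivrMr ?mul1r ?ltrDr //; pos.
move=> n; rewrite lerBlDl (mulrAC _ `|_|).
exact: defect_bound_iter.
Qed.

(** The chord slope differs from [slope] by the defect divided by the first deviation, and the
    defect is quadratic in that deviation. *)
Lemma curve_tangent :
  (fun x => (height x - height (k + c)) / (x - (k + c))) @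
    within base (k + c)^' --> slope.
Proof.
have [_ hE] := curve_E; rewrite /= in hE; rewrite -hE.
have d0 := defect_const_gt0.
pose K := defect_const * (k + c) / k.
have K0 : 0 < K by rewrite /K; pos.
apply/cvgrPdist_le => /= e e0; rewrite near_withinE.
apply/nbhs_ballP; exists (Num.min k (e / K)) => /=.
  by rewrite lt_min k_gt0 divr_gt0.
move=> x; rewrite /ball /= lt_min => /andP[xk xe] xneq bx.
have u0 : x - (k + c) != 0 by rewrite subr_eq0.
have cx : curve (x, height x) by [].
have uk : `|x - (k + c)| <= k by rewrite distrC ltW.
have := defect_bound cx uk; rewrite /defect /= => h.
have -> : slope - (height x - B * c) / (x - (k + c)) =
  - ((height x - B * c - slope * (x - (k + c))) / (x - (k + c))) by field.
rewrite normrN normrM normfV ler_pdivrMr ?normr_gt0 //.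
apply: (le_trans h); rewrite -/K expr2 mulrA ler_wpM2r //.
by rewrite mulrC -ler_pdivlMr // distrC ltW.
Qed.

(* The functional measuring the gap is an eigenvector of the transposed
   linearization for the eigenvalue 1, and ordered differences have
   nonnegative coordinates on which the linearization acts positively. *)
Lemma gap_expansion p q (r : R) : basin T E p -> basin T E q -> le_se q p ->
  r < 1 ->
  \forall n \near \oo,
    r * (slope * ((iter n T p).1 - (iter n T q).1) +
         ((iter n T q).2 - (iter n T p).2)) <=
    slope * ((iter n.+1 T p).1 - (iter n.+1 T q).1) +
         ((iter n.+1 T q).2 - (iter n.+1 T p).2).
Proof.
move=> bp bq qp r1; have /basinP[dp [px py]] := bp.
have /basinP[dq [qx qy]] := bq.
have kc0 : k + c != 0 by rewrite gt_eqF //; pos.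
have s0 := slope_gt0.
pose X n := (iter n T p).1; pose Y n := (iter n T p).2.
pose x n := (iter n T q).1; pose y n := (iter n T q).2.
pose w n := ((B * x n + y n) * (B * X n + Y n))^-1.
pose z n := (x n * X n)^-1.
have cstM (a : R) (u : nat -> R) (l : R) : u @ \oo --> l -> (fun n => a * u n) @ \oo --> a * l.
  by move=> ul; apply: cvgM => //; exact: cvg_cst.
have wl : w @ \oo --> ((B * (k + c) + B * c) * (B * (k + c) + B * c))^-1.
  apply: cvgV; first by rewrite gt_eqF //; pos.
  by apply: cvgM; apply: cvgD => //; exact: cstM.
have zl : z @ \oo --> ((k + c) * (k + c))^-1.
  by apply: cvgV; [rewrite mulf_neq0|exact: cvgM].
(* One step later, the coefficients of the two coordinate gaps tend to [slope] and 1, their values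
   in the functional itself; a factor [r < 1] leaves room for the error. *)
have h1 : \forall n \near \oo, r * slope <
    slope * (B * (k + 2 * c)) * (y n * w n) + (B * c ^+ 2 + k * y n) * z n.
  suff : (fun n => slope * (B * (k + 2 * c)) * (y n * w n) +
    (B * c ^+ 2 + k * y n) * z n) @ \oo --> slope * (B * (k + 2 * c)) *
     (B * c * ((B * (k + c) + B * c) * (B * (k + c) + B * c))^-1) +
     (B * c ^+ 2 + k * (B * c)) * ((k + c) * (k + c))^-1.
    move/cvgr_gt; apply; rewrite [ltRHS](_ : _ = slope) ?gtr_pMl //.
    by rewrite /slope; field; rewrite kc0 !gt_eqF //; pos.
  apply: cvgD; first by apply: cstM; exact: cvgM.
  by apply: cvgM => //; apply: cvgD; [exact: cvg_cst|exact: cstM].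
have h2 : \forall n \near \oo, r <
    slope * (B * (k + 2 * c)) * (x n * w n) + k * (x n * z n).
  suff : (fun n => slope * (B * (k + 2 * c)) * (x n * w n) + k * (x n * z n))
     @ \oo --> slope * (B * (k + 2 * c)) *
     ((k + c) * ((B * (k + c) + B * c) * (B * (k + c) + B * c))^-1) +
     k * ((k + c) * ((k + c) * (k + c))^-1).
    move/cvgr_gt; apply; rewrite [ltRHS](_ : _ = 1) //.
    by rewrite /slope; field; rewrite kc0 !gt_eqF //; pos.
  by apply: cvgD; apply: cstM; exact: cvgM.
near=> n.
have n1 : r * slope <
    slope * (B * (k + 2 * c)) * (y n * w n) + (B * c ^+ 2 + k * y n) * z n.
  by near: n.
have n2 : r <
    slope * (B * (k + 2 * c)) * (x n * w n) + k * (x n * z n).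
  by near: n.
have [D1 D2] := iter_mono n dq dp qp.
have dqn := iter_dom n dq; have dpn := iter_dom n dp.
rewrite !iterS Tcrit_diff1 // Tcrit_diff2 // -/(X n) -/(Y n) -/(x n) -/(y n).
rewrite -/(w n) -/(z n) in D1 D2 *.
have {}D1 : 0 <= X n - x n by rewrite subr_ge0.
have {}D2 : 0 <= y n - Y n by rewrite subr_ge0.
have -> : slope * (B * (k + 2 * c) * ((X n - x n) * y n + x n * (y n - Y n)) * w n) +
   ((X n - x n) * (B * c ^+ 2 + k * y n) + k * x n * (y n - Y n)) * z n =
   (slope * (B * (k + 2 * c)) * (y n * w n) + (B * c ^+ 2 + k * y n) * z n) * (X n - x n) +
   (slope * (B * (k + 2 * c)) * (x n * w n) + k * (x n * z n)) * (y n - Y n) by ring.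
by rewrite mulrDr mulrA; apply: lerD; apply: ler_wpM2r => //; exact: ltW.
Unshelve. all: by end_near. Qed.

Lemma orbit_contraction p : basin T E p -> (forall n, diag (iter n T p)) ->
  \forall n \near \oo,
    `|(iter n.+1 T p).1 - (k + c)| <= c / (k + c) * `|(iter n T p).1 - (k + c)|.
Proof.
move=> bp dg; have /basinP[dp [px _]] := bp.
have : \forall n \near \oo, c < (iter n T p).1.
  by apply: (cvgr_gt _ px); rewrite ltrDr.
apply: filterS => n cx.
apply: diag_contraction (dg n) (dg n.+1) (dg n.+2) (ltW cx); exact: iter_dom.
Qed.

(** Eventually the distances to [E] shrink by the factor [rho] at each step, while the gap between
    distinct ordered orbits keeps at least a fraction [r > rho]. Since these distances dominate the
    gap, the gap would have to vanish. *)
Lemma ordered_diag_orbits_eq p q : basin T E p -> basin T E q -> le_se q p ->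
  (forall n, diag (iter n T p)) -> (forall n, diag (iter n T q)) -> q = p.
Proof.
move=> bp bq qp dgp dgq; apply: contrapT => neq.
have s0 := slope_gt0.
have [[dp _] [dq _]] := (bp, bq).
pose rho := c / (k + c).
have rho0 : 0 < rho by rewrite /rho; pos.
have rho1 : rho < 1 by rewrite /rho ltr_pdivrMr ?mul1r ?ltrDr //; pos.
pose r := (1 + rho) / 2.
have r1 : r < 1 by rewrite /r; lra.
have rr : rho < r by rewrite /r; lra.
have r0 : 0 < r by exact: lt_trans rr.
pose gap n := slope * ((iter n T p).1 - (iter n T q).1) +
         ((iter n T q).2 - (iter n T p).2).
pose W n := `|(iter n T p).1 - (k + c)| + `|(iter n T q).1 - (k + c)|.
have gapW n : gap n <= (slope + B * c / k) * W n.
  have v (o : R * R) : dom o -> (forall n, diag (iter n T o)) ->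
      `|(iter n T o).2 - B * c| <= B * c / k * `|(iter n T o).1 - (k + c)|.
    move=> d_o dgo; rewrite mulrAC ler_pdivlMr // mulrC.
    by have [] := diag_cone (iter_dom n d_o) (dgo n) (dgo n.+1).
  have vp := v p dp dgp; have vq := v q dq dgq.
  rewrite /gap /W mulrDl; apply: lerD.
    rewrite ler_pM2l // (le_trans (ler_norm _)) //.
    have -> : (iter n T p).1 - (iter n T q).1 =
      ((iter n T p).1 - (k + c)) - ((iter n T q).1 - (k + c)) by ring.
    exact: ler_normB.
  rewrite (le_trans (ler_norm _)) //.
  have -> : (iter n T q).2 - (iter n T p).2 =
    ((iter n T q).2 - B * c) - ((iter n T p).2 - B * c) by ring.
  by rewrite (le_trans (ler_normB _ _)) // addrC mulrDr lerD.
(* The orbits never merge: distinct ordered points have strictly ordered second images. *)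
have neqn n : iter n T q <> iter n T p.
  elim: n => // n IH eqn.
  have [] := Tcrit_strict_mono2 (iter_dom n dq) (iter_dom n dp)
    (iter_mono n dq dp qp) IH.
  by rewrite -(iterS n T q) eqn ltxx.
have gap_gt0 n : 0 < gap n.
  have [D1 D2] := iter_mono n dq dp qp.
  have [e|D2'] := eqVneq (iter n T p).2 (iter n T q).2.
    rewrite /gap e subrr addr0 mulr_gt0 // subr_gt0 lt_neqAle D1 andbT.
    apply/eqP => e1; apply: (neqn n).
    by rewrite [LHS]surjective_pairing [RHS]surjective_pairing e e1.
  rewrite /gap ltr_wpDl //; first by pos.
  by rewrite subr_gt0 lt_neqAle D2'.
have [N hN] : exists N, forall n, (N <= n)%N ->
    r * gap n <= gap n.+1 /\ W n.+1 <= rho * W n.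
  have : \forall n \near \oo, r * gap n <= gap n.+1 /\ W n.+1 <= rho * W n.
    near=> n; split; first by near: n; exact: gap_expansion.
    rewrite /W mulrDr; apply: lerD.
      by near: n; exact: orbit_contraction.
    by near: n; exact: orbit_contraction.
  by move=> [N _ hN]; exists N.
have gapn n : r ^+ n * gap N <= gap (n + N)%N.
  elim: n => [|n IH]; first by rewrite mul1r.
  have [h _] := hN (n + N)%N (leq_addl _ _).
  by rewrite exprS -mulrA addSn (le_trans _ h) // ler_pM2l.
have Wn n : W (n + N)%N <= rho ^+ n * W N.
  elim: n => [|n IH]; first by rewrite mul1r.
  have [_ h] := hN (n + N)%N (leq_addl _ _).
  by rewrite exprS -mulrA addSn (le_trans h) // ler_pM2l.
suff : gap N <= 0 by rewrite leNgt gap_gt0.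
apply: (geometric_le0 (r := rho / r) (b := (slope + B * c / k) * W N)).
  by rewrite divr_ge0 ?ltW //= ltr_pdivrMr // mul1r.
move=> n; rewrite expr_div_n mulrA ler_pdivlMr ?exprn_gt0 // mulrC.
apply: (le_trans (gapn n)); apply: (le_trans (gapW _)).
rewrite -[leRHS]mulrA ler_pM2l; last by pos.
by rewrite [leRHS]mulrC.
Unshelve. all: by end_near. Qed.

(** A point of [C] off the curve is strictly above some curve point. Both orbits tend to [E] along
    increasing graphs through [E], so the two points would have to coincide. *)
Lemma admissible_sub_curve (lambda : R) (C : set (R * R)) :
  admissible_curve T E lambda C -> C `<=` curve.
Proof.
move=> [Cdom CE Cinv Cbasin [I [f [CI inc _]]]] p Cp; apply: contrapT => ncp.
have bp := Cbasin p Cp.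
have [q [cq qp neq]] := curve_below bp ncp.
apply: neq; apply: ordered_diag_orbits_eq => //; first exact: curve_basin.
  move=> n; have : C (iter n T p).
    by elim: n => //= n IH; apply: Cinv; exists (iter n T p).
  by move: CE; rewrite CI; exact: increasing_graph_diag.
by move=> n; apply: curve_diag; exact: curve_iter.
Qed.

(** * Jacobian matrix *)

Lemma ord2P (j : 'I_2) : j = 0 \/ j = 1.
Proof. by case: j => -[|[|//]] hj; [left|right]; apply: val_inj. Qed.

Lemma row2_norm_le (v : 'rV[R]_2) (e : R) : 0 <= e ->
  `|v 0 0| <= e -> `|v 0 1| <= e -> `|v| <= e.
Proof.
move=> e0 h0 h1; rewrite [leLHS]/Num.Def.normr /= mx_normrE.
apply: bigmax_le => // -[i j] _ /=; rewrite ord1.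
by have [->|->] := ord2P j.
Qed.

Lemma row2_norm_ge (v : 'rV[R]_2) j : `|v 0 j| <= `|v|.
Proof.
rewrite [leRHS]/Num.Def.normr /= mx_normrE.
exact: (le_bigmax _ (fun ij : 'I_1 * 'I_2 => `|v ij.1 ij.2|) (0, j)).
Qed.

(* Transposed, as [jac] acts on row vectors. *)
Definition Jcrit : 'M[R]_2 := \matrix_(i, j)
  if i == 0 then if j == 0 then c / (k + 2 * c) else - (B * c) / (k + c)
  else if j == 0 then - (k + c) / (B * (k + 2 * c)) else k / (k + c).

Lemma mulmx_Jcrit (h : 'rV[R]_2) :
  (h *m Jcrit) 0 0 = (B * c * h 0 0 - (k + c) * h 0 1) / (B * (k + 2 * c)) /\
  (h *m Jcrit) 0 1 = (k * h 0 1 - B * c * h 0 0) / (k + c).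
Proof.
split; rewrite !mxE !big_ord_recl big_ord0 addr0 !mxE /=;
  rewrite (_ : lift ord0 ord0 = 1); try exact: val_inj.
  by field; rewrite !gt_eqF //; pos.
by field; rewrite !gt_eqF //; pos.
Qed.

Lemma tangent_bound (a b u v m e : R) : 0 <= a -> 0 <= b -> 0 < m -> 0 <= e ->
  `|u| <= e -> `|v| <= e -> `|(a * u - b * v) / m| <= (a + b) / m * e.
Proof.
move=> a0 b0 m0 e0 ue ve; rewrite normrM normfV (gtr0_norm m0) mulrAC.
rewrite ler_pM2r ?invr_gt0 //; apply: (le_trans (ler_normB _ _)).
rewrite !normrM (ger0_norm a0) (ger0_norm b0) mulrDl.
by apply: lerD; apply: ler_wpM2l.
Qed.

Lemma mulmx_Jcrit_continuous : continuous (mulmxr Jcrit : 'rV[R]_2 -> 'rV[R]_2).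
Proof.
apply: bounded_linear_continuous.
pose M := (B * c + (k + c)) / (B * (k + 2 * c)) + (k + B * c) / (k + c).
have M0 : 0 < M by rewrite /M; pos.
exists M; split; first exact: gtr0_real.
move=> N MN; apply/nbhs_ballP; exists 1 => //= h.
rewrite -ball_normE /= sub0r normrN => h1; apply: le_trans (ltW MN).
have [e0 e1] := mulmx_Jcrit h.
have h00 : `|h 0 0| <= 1 := le_trans (row2_norm_ge h 0) (ltW h1).
have h01 : `|h 0 1| <= 1 := le_trans (row2_norm_ge h 1) (ltW h1).
apply: row2_norm_le; rewrite ?e0 ?e1; first exact: ltW.
  apply: (@le_trans _ _ ((B * c + (k + c)) / (B * (k + 2 * c)) * 1)).
    by apply: tangent_bound => //; pos.
  by rewrite mulr1 lerDl; pos.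
apply: (@le_trans _ _ ((k + B * c) / (k + c) * 1)).
  by apply: tangent_bound => //; pos.
by rewrite mulr1 lerDr; pos.
Qed.

(** By uniqueness of the differential it suffices that the remainder be negligible. The deviation
    identities express it as a deviation of the image times a linear form in [h], hence it is
    quadratic in [h]. *)
Lemma jac_Tcrit : jac T E = Jcrit.
Proof.
rewrite /jac /jacobian.
set f := fun v : 'rV[R]_2 => _.
have -> : 'd f (row_of_pair E) = mulmxr Jcrit :> ('rV[R]_2 -> 'rV[R]_2).
  apply: diff_unique; first exact: mulmx_Jcrit_continuous.
  apply/eqaddoP => /= e e0.
  (* [M1] and [M2] bound the growth of the two deviations near [E], where the denominators are at
     least [B (k + c) / 2] and [(k + c) / 2]. *)
  pose M1 := (B * c + (k + c)) / (B * (k + c) / 2).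
  pose M2 := (k + B * c) / ((k + c) / 2).
  have M10 : 0 < M1 by rewrite /M1; pos.
  have M20 : 0 < M2 by rewrite /M2; pos.
  pose K := M1 * (B + 1) / (B * (k + 2 * c)) + M2 / (k + c).
  have K0 : 0 < K by rewrite /K; pos.
  (* The first two bounds keep the perturbed point in the domain with [p.1 >= (k + c) / 2]; the
     third one makes the quadratic remainder at most [e] times the norm of [h]. *)
  pose d := Num.min (Num.min ((k + c) / 2) (B * c)) (e / K).
  have d0 : 0 < d by rewrite /d !lt_min; apply/andP; split; [apply/andP; split|]; pos.
  apply/nbhs_ballP; exists d => //= h.
  rewrite -ball_normE /= sub0r normrN /d !lt_min => /andP[/andP[hd1 hd2] hd3].
  have h00 := row2_norm_ge h 0; have h01 := row2_norm_ge h 1.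
  have h0 := normr_ge0 h.
  have n0 := lerNnormlW h00; have n1 := lerNnormlW h01.
  pose p : R * R := (k + c + h 0 0, B * c + h 0 1).
  have px : (k + c) / 2 <= p.1 by rewrite /p /=; lra.
  have py : 0 <= p.2 by rewrite /p /=; lra.
  have dp : dom p by split => //; apply: lt_le_trans px; pos.
  have ps : B * (k + c) / 2 <= B * p.1 + p.2.
    apply: (@le_trans _ _ (B * p.1)); last by rewrite lerDl.
    by rewrite -mulrA ler_pM2l.
  have s0 := dom_sum_gt0 dp; have x0 : 0 < p.1 by case: dp.
  have fh : f (h + row_of_pair E) = row_of_pair (T p).
    rewrite /f /pair_of_row /p; congr (row_of_pair (T (_, _)));
      by rewrite !mxE /= addrC.
  have fE : f (row_of_pair E) = row_of_pair E.
    rewrite /f -[in RHS]Tcrit_fixed; congr (row_of_pair (T _)).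
    by rewrite /pair_of_row !mxE.
  have [e1 e2] := mulmx_Jcrit h.
  have pu : p.1 - (k + c) = h 0 0 by rewrite /p /= addrC addKr.
  have pv : p.2 - B * c = h 0 1 by rewrite /p /= addrC addKr.
  have t1 := Tcrit_dev1 dp; have t2 := Tcrit_dev2 dp.
  rewrite pu pv in t1 t2.
  have b1 : `|(T p).1 - (k + c)| <= M1 * `|h|.
    rewrite -[(T p).1 - _](mulfK (lt0r_neq0 s0)) t1.
    apply: (@le_trans _ _ ((B * c + (k + c)) / (B * p.1 + p.2) * `|h|)).
      by apply: tangent_bound => //; pos.
    rewrite ler_wpM2r // ler_pM2l ?lef_pV2 ?posrE //; last by pos.
    by pos.
  have b2 : `|(T p).2 - B * c| <= M2 * `|h|.
    rewrite -[(T p).2 - _](mulfK (lt0r_neq0 x0)) t2.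
    apply: (@le_trans _ _ ((k + B * c) / p.1 * `|h|)).
      by apply: tangent_bound => //; pos.
    rewrite ler_wpM2r // ler_pM2l ?lef_pV2 ?posrE //; last by pos.
    by pos.
  have r1 : (T p).1 - ((k + c) + (h *m Jcrit) 0 0) =
      - (((T p).1 - (k + c)) * (B * h 0 0 + h 0 1) / (B * (k + 2 * c))).
    rewrite e1 -t1 /p /=; field; rewrite !gt_eqF //; pos.
  have r2 : (T p).2 - (B * c + (h *m Jcrit) 0 1) =
      - (((T p).2 - B * c) * h 0 0 / (k + c)).
    rewrite e2 -t2 /p /=; field; rewrite !gt_eqF //; pos.
  have kc0 : 0 < k + c by pos.
  have bk0 : 0 < B * (k + 2 * c) by pos.
  have hK : K * `|h| <= e by rewrite mulrC -ler_pdivlMr // ltW.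
  have hKh : K * `|h| * `|h| <= e * `|h| by rewrite ler_wpM2r.
  have eh0 : 0 <= e * `|h| by rewrite mulr_ge0 // ltW.
  rewrite [X in `|X|](_ : _ = row_of_pair ((T p).1 - ((k + c) + (h *m Jcrit) 0 0),
      (T p).2 - (B * c + (h *m Jcrit) 0 1))); last first.
    apply/rowP => j; rewrite -[LHS]/((f (h + row_of_pair E) -
      (f (row_of_pair E) + h *m Jcrit)) 0 j) fh fE.
    by have [->|->] := ord2P j; rewrite !mxE.
  apply: row2_norm_le => //; rewrite mxE /=.
    rewrite r1 normrN !normrM normfV (gtr0_norm bk0).
    apply: le_trans hKh.
    have sum : `|B * h 0 0 + h 0 1| <= (B + 1) * `|h|.
      rewrite (le_trans (ler_normD _ _)) // mulrDl mul1r normrM (gtr0_norm B_gt0).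
      by apply: lerD => //; rewrite ler_pM2l.
    apply: (@le_trans _ _ (M1 * `|h| * ((B + 1) * `|h|) / (B * (k + 2 * c)))).
      by rewrite ler_pM2r ?invr_gt0 //; apply: ler_pM.
    have -> : M1 * `|h| * ((B + 1) * `|h|) / (B * (k + 2 * c)) =
      M1 * (B + 1) / (B * (k + 2 * c)) * `|h| * `|h| by ring.
    rewrite ler_wpM2r // ler_wpM2r // /K lerDl; pos.
  rewrite r2 normrN !normrM normfV (gtr0_norm kc0).
  apply: le_trans hKh.
  apply: (@le_trans _ _ (M2 * `|h| * `|h| / (k + c))).
    by rewrite ler_pM2r ?invr_gt0 //; apply: ler_pM.
  have -> : M2 * `|h| * `|h| / (k + c) = M2 / (k + c) * `|h| * `|h| by ring.
  rewrite ler_wpM2r // ler_wpM2r // /K lerDr; pos.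
by apply/matrixP => i j; rewrite mxE /= -rowE [LHS]mxE.
Qed.

Definition lambda2 : R := - (c ^+ 2 / ((k + 2 * c) * (k + c))).

Lemma lambda2_itv : -1 < lambda2 < 0.
Proof.
rewrite /lambda2 oppr_lt0 ltrN2; apply/andP; split; last by pos.
rewrite ltr_pdivrMr ?mul1r; last by pos.
rewrite -subr_gt0.
suff -> : (k + 2 * c) * (k + c) - c ^+ 2 = k ^+ 2 + 3 * (k * c) + c ^+ 2 by pos.
by ring.
Qed.

Lemma char_poly_Jcrit : char_poly Jcrit = ('X - 1%:P) * ('X - lambda2%:P).
Proof.
rewrite char_poly_mx22 !mxE /=.
have -> : c / (k + 2 * c) + k / (k + c) = 1 + lambda2.
  by rewrite /lambda2; field; rewrite !gt_eqF //; pos.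
have -> : c / (k + 2 * c) * (k / (k + c)) -
    - (B * c) / (k + c) * (- (k + c) / (B * (k + 2 * c))) = lambda2.
  by rewrite /lambda2; field; rewrite !gt_eqF //; pos.
by rewrite polyCD; ring.
Qed.

Lemma slope_eigenspace :
  (row_of_pair (1%R, slope) <= eigenspace Jcrit lambda2)%MS.
Proof.
apply/eigenspaceP/rowP => j.
have [e0 e1] := mulmx_Jcrit (row_of_pair (1, slope)).
have [->|->] := ord2P j; rewrite ?e0 ?e1 !mxE /= /slope /lambda2; field;
  rewrite !gt_eqF //; pos.
Qed.

Lemma nonhyperbolic_E : nonhyperbolic T E.
Proof.
exists 1; last exact: normr1.
rewrite jac_Tcrit eigenvalue_root_char -map_char_poly char_poly_Jcrit.
by rewrite rmorphM rootM !rmorphB /= map_polyX map_polyC /= rmorph1 root_XsubC eqxx.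
Qed.

(** * Conclusions in the parameters [B], [c], [k] *)

Lemma equilibria_Tcrit : equilibria T = [set E].
Proof.
apply/seteqP; split => p /=; first by move=> [dp]; exact: Tcrit_fixed_unique.
by move=> ->; split; [exact: Ecrit_dom|exact: Tcrit_fixed].
Qed.

Lemma curve_admissible : admissible_curve T E lambda2 curve.
Proof.
split.
- by move=> p /curve_basin[].
- exact: curve_E.
- by move=> _ [p cp <-]; exact: curve_invariant.
- by move=> p; exact: curve_basin.
exists base, height; split => //; first exact: curve_increasing_on.
exists slope; split; first exact: curve_tangent.
by rewrite jac_Tcrit; exact: slope_eigenspace.
Qed.

Lemma curve_maximal : maximal_curve T E lambda2 curve.
Proof.
split; first exact: curve_admissible.
move=> C adm sub; apply/seteqP; split => //; exact: admissible_sub_curve adm.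
Qed.

Lemma maximal_curve_unique C : maximal_curve T E lambda2 C -> C = curve.
Proof.
by move=> [adm max]; rewrite (max _ curve_admissible (admissible_sub_curve adm)).
Qed.

Lemma curve_semi_stable : semi_stable T E curve.
Proof.
left; rewrite WplusE WminusE; split; first by move=> p [].
by apply/seteqP; split => // p [[_]].
Qed.

Lemma basin_curve : basin T E = curve `|` Wplus curve.
Proof.
rewrite WplusE; apply/seteqP; split => p.
  by move=> bp; have [cp|ncp] := pselect (curve p); [left|right].
by move=> [/curve_basin|[]].
Qed.

Lemma Wminus_asymptotic p : Wminus curve p -> asymptotic_0_infty T p.
Proof. by rewrite WminusE => -[dp nbp]; case: (dichotomy dp nbp). Qed.

End CriticalSystem.

(** * Return to the original parameters *)

Theorem theorem13 (R : realType) (beta1 B1 alpha2 gamma2 : R)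
    (hbeta1 : 0 < beta1) (hB1 : 0 < B1) (halpha2 : 0 < alpha2) (hgamma2 : 0 < gamma2)
    (hcrit : beta1 - B1 * gamma2 = 2 * Num.sqrt (B1 * alpha2)) :
  let T := Tmap beta1 B1 alpha2 gamma2 in
  let E := equi beta1 B1 gamma2 in
  [/\ equilibria T = [set E],
      nonhyperbolic T E &
      exists lambda2 : R,
        [/\ -1 < lambda2 < 0,
            char_poly (jac T E) = ('X - 1%:P) * ('X - lambda2%:P) &
            exists C : set (R * R),
              [/\ maximal_curve T E lambda2 C /\
                    (forall C', maximal_curve T E lambda2 C' -> C' = C),
                  curve_endpoint C `&` (dom R)° = set0 /\ separates C,
                  semi_stable T E C,
                  basin T E = C `|` Wplus C &
                  forall p, Wminus C p -> asymptotic_0_infty T p]]].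
Proof.
move=> T E.
pose c := Num.sqrt (B1 * alpha2) / B1.
have c0 : 0 < c by rewrite /c divr_gt0 // sqrtr_gt0 mulr_gt0.
have Bc : B1 * c = Num.sqrt (B1 * alpha2) by rewrite /c mulrC divfK ?gt_eqF.
move: c c0 Bc => c c0 Bc.
have eb : beta1 = B1 * (gamma2 + 2 * c).
  by rewrite mulrDr mulrCA Bc -hcrit addrC subrK.
have ea : alpha2 = B1 * c ^+ 2.
  apply: (mulfI (lt0r_neq0 hB1)).
  by rewrite -(sqr_sqrtr (ltW (mulr_gt0 hB1 halpha2))) -Bc; ring.
have -> : T = Tcrit B1 c gamma2 by rewrite /T eb ea.
have -> : E = Ecrit B1 c gamma2.
  rewrite /E /equi eb /Ecrit; congr pair; last by field.
  by field; rewrite gt_eqF.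
split; first exact: equilibria_Tcrit.
  exact: nonhyperbolic_E.
exists (lambda2 c gamma2); split.
- exact: lambda2_itv.
- by rewrite jac_Tcrit //; exact: char_poly_Jcrit.
exists (curve B1 c gamma2); split.
- split; first exact: curve_maximal.
  by move=> C'; exact: maximal_curve_unique.
- split; [exact: curve_no_endpoint|exact: curve_separates].
- exact: curve_semi_stable.
- exact: basin_curve.
- by move=> p; exact: Wminus_asymptotic.
Qed.
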